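(* Let $N>2$, $s\in(1/2,1)$, and let $\Omega\subset\mathbb{R}^N$ be a bounded strictly convex domain. Let $u_0\in\mathcal{C}(\mathbb{R}^N)$ and $g$ satisfy $\Lambda_1^s u_0\in L^\infty(\Omega)$, $g\in\mathcal{C}(\mathbb{R}^N\setminus\Omega)\cap L^\infty(\mathbb{R}^N\setminus\Omega)$ and $u_0=g$ in $\mathbb{R}^N\setminus\Omega$. Let $u$ be the unique viscosity solution of $$\begin{cases} u_t=\Lambda_1^s u &\text{in }\Omega\times(0,\infty),\\ u(x,t)=g(x) &\text{in }(\mathbb{R}^N\setminus\Omega)\times(0,\infty),\\ u(x,0)=u_0(x)&\text{in }\mathbb{R}^N,\end{cases}$$ and let $z$ be the unique viscosity solution of $-\Lambda_1^s z=0$ in $\Omega$, $z=g$ in $\mathbb{R}^N\setminus\Omega$. Then: (i) There exist $C=C(u_0)>0$ and $\mu>0$ such that $$\|u(\cdot,t)-z(\cdot)\|_{L^\infty(\overline\Omega)}\le Ce^{-\mu t},\qquad t>0.$$ (ii) When $g\equiv0$ and $u_0$ is compactly supported inside $\Omega$, there is a universal constant $H>0$ (depending only on $s$) such that for every $\mu>0$ there exist $C>0$ and $K=K(\mu)$ with $$-Ce^{-\mu_1 t}\le u(x,t)\le Ke^{-\mu^s Ht},\qquad x\in\overline\Omega,\ t>0,$$ where $\mu_1$ denotes the first eigenvalue of the operator $-\Lambda_1^s$ in $\Omega$.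
   Context: The operator is $\Lambda_1^s u(x)=\inf_{\theta\in\mathbb{S}^{N-1}}\int_{\mathbb{R}}\frac{u(x+\tau\theta)-u(x)}{|\tau|^{1+2s}}\,d\tau$, acting in the space variable; integrals are in the principal value sense. ''Bounded strictly convex domain'' means a bounded domain with $\mathcal{C}^2$ boundary such that all principal curvatures of $\partial\Omega$ are positive everywhere. The first eigenvalue $\mu_1>0$ is a number for which there is $\varphi_1\in\mathcal{C}(\mathbb{R}^N)$, negative in $\Omega$, that solves in the viscosity sense $-\Lambda_1^s\varphi_1=\mu_1\varphi_1$ in $\Omega$, $\varphi_1=0$ in $\mathbb{R}^N\setminus\Omega$ (such a pair exists for $s>1/2$). Viscosity solutions of the elliptic problem $-\Lambda_1^s u=f$ in $\Omega$, $u=g$ in $\mathbb{R}^N\setminus\Omega$ (with $f=0$ for $z$ and $f=\mu_1\varphi_1$ for the eigenvalue problem): a bounded upper (resp. lower) semicontinuous $u:\mathbb{R}^N\to\mathbb{R}$ is a subsolution (resp. supersolution) if $u\le g$ (resp. $\ge$) in $\mathbb{R}^N\setminus\Omega$ and, whenever $\varphi$ is smooth and $x_0\in\Omega$ is a maximum (resp. minimum) point of $u-\varphi$ in some $B_\delta(x_0)\subseteq\Omega$, $$-\inf_{\theta\in\mathbb{S}^{N-1}}\left\{\int_{-\delta}^{\delta}\frac{\varphi(x_0+\tau\theta)-\varphi(x_0)}{|\tau|^{1+2s}}d\tau+\int_{\mathbb{R}\setminus(-\delta,\delta)}\frac{u(x_0+\tau\theta)-u(x_0)}{|\tau|^{1+2s}}d\tau\right\}\le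 f(x_0)\quad(\text{resp. }\ge).$$ A solution is both. Viscosity solutions of the evolution problem: for $T>0$, a bounded upper (resp. lower) semicontinuous $u:\mathbb{R}^N\times[0,T]\to\mathbb{R}$ is a subsolution (resp. supersolution) on $(0,T)$ if $u\le g$ (resp. $\ge$) in $(\mathbb{R}^N\setminus\Omega)\times[0,T)$, $u(\cdot,0)\le u_0$ (resp. $\ge$) in $\Omega$, and for every smooth $\varphi$ and every maximum (resp. minimum) point $(x_0,t_0)\in\Omega\times(0,T)$ of $u-\varphi$ in $B_\delta(x_0)\times(t_0-\delta,t_0+\delta)\subseteq\Omega\times(0,T)$, for some $\delta>0$, $$\varphi_t(x_0,t_0)-\inf_{\theta\in\mathbb{S}^{N-1}}\left\{\int_{-\delta}^{\delta}\frac{\varphi(x_0+\tau\theta,t_0)-\varphi(x_0,t_0)}{|\tau|^{1+2s}}d\tau+\int_{\mathbb{R}\setminus(-\delta,\delta)}\frac{u(x_0+\tau\theta,t_0)-u(x_0,t_0)}{|\tau|^{1+2s}}d\tau\right\}\le0\quad(\text{resp. }\ge0).$$ A bounded upper (resp. lower) semicontinuous function on $\mathbb{R}^N\times[0,\infty)$ is a subsolution (resp. supersolution) of the evolution problem if it is one on $(0,T)$ for every $T>0$; a solution is a continuous function that is both. Under the stated assumptions the solutions $u$ and $z$ exist and are unique. *)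

(* Defs.v *)
From HB Require Import structures.
From mathcomp Require Import all_boot all_order all_algebra.
From mathcomp Require Import all_classical all_reals all_analysis.

Set Implicit Arguments.
Unset Strict Implicit.
Unset Printing Implicit Defensive.

Import Order.TTheory GRing.Theory Num.Theory.
Import numFieldNormedType.Exports.

Local Open Scope classical_set_scope.
Local Open Scope ring_scope.

Section Euclidean.
Context {R : realType} {N : nat}.
Implicit Types (x y v : 'rV[R]_N) (A : set 'rV[R]_N).

(* The library norm on 'rV[R]_N is the sup norm, hence these definitions.
   The induced topologies and the bounded sets are the same. *)
Definition dot x y : R := \sum_i x 0 i * y 0 i.

Definition enorm x : R := Num.sqrt (dot x x).

Definition eball x (r : R) : set 'rV[R]_N := [set y | enorm (y - x) < r].

Definition esphere : set 'rV[R]_N := [set v | enorm v = 1].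

Definition lebesgue_null A := forall e : R, 0 < e ->
  exists a b : nat -> 'rV[R]_N,
    [/\ forall k i, a k 0 i <= b k 0 i,
        A `<=` \bigcup_k [set x | forall i, a k 0 i <= x 0 i <= b k 0 i] &
        (\sum_(0 <= k <oo) (\prod_i (b k 0 i - a k 0 i))%:E <= e%:E)%E].

End Euclidean.

(* In finite dimension, existence and continuity of all iterated directional
   derivatives of order at most k is the usual class C^k. *)
Fixpoint Ck {R : realType} {V : normedModType R} (k : nat) (f : V -> R) : Prop :=
  if k is k'.+1 then
    continuous f /\
    forall v, (forall x, derivable f x v) /\ Ck k' (fun x => 'D_v f x)
  else continuous f.

Definition smooth {R : realType} {V : normedModType R} (f : V -> R) :=
  forall k, Ck k f.

Definition upper_semicontinuous {R : realType} {X : topologicalType}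
  (f : X -> R) := lower_semicontinuous (fun x => (- f x)%:E).

(* For f continuous on A, with A the closure of an open set, this supremum is
   the L^oo(A) norm of f. *)
Definition sup_norm_on {R : realType} {T : Type} (A : set T) (f : T -> R) :
  \bar R := ereal_sup [set `|f x|%:E | x in A].

Section Domain.
Context {R : realType} {N : nat}.
Implicit Types (Omega : set 'rV[R]_N) (p x : 'rV[R]_N) (rho : 'rV[R]_N -> R).

Definition grad rho x : 'rV[R]_N := \row_i 'D_(delta_mx 0 i) rho x.

Definition defining_function Omega p rho (r : R) :=
  [/\ Ck 2 rho, grad rho p != 0, 0 < r &
      forall x, eball p r x -> (Omega x <-> rho x < 0)].

Definition C2_boundary Omega :=
  forall p, (closure Omega `\` Omega) p ->
    exists rho r, defining_function Omega p rho r.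

(* As rho < 0 inside, this is the outward unit normal along the boundary. *)
Definition unit_normal rho x : 'rV[R]_N := (enorm (grad rho x))^-1 *: grad rho x.

(* The principal curvatures at p are the eigenvalues of the shape operator, the
   differential of the Gauss map on the tangent space; with the outward normal
   those of a sphere are positive. *)
Definition principal_curvature Omega p (kappa : R) :=
  exists rho r v,
    [/\ defining_function Omega p rho r,
        v != 0, dot v (grad rho p) = 0 &
        'D_v (unit_normal rho) p = kappa *: v].

Definition strictly_convex_domain Omega :=
  [/\ Omega !=set0, open Omega, connected Omega & bounded_set Omega] /\
  C2_boundary Omega /\
  (forall p kappa, (closure Omega `\` Omega) p ->
     principal_curvature Omega p kappa -> 0 < kappa).

End Domain.

Section Operator.
Context {R : realType} {N : nat}.
Implicit Types (s delta : R) (x theta : 'rV[R]_N) (u phi : 'rV[R]_N -> R).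

Definition incr_quot s u x theta (tau : R) : R :=
  (u (x + tau *: theta) - u x) / (`|tau| `^ (1 + 2 * s)).

Definition pv_trunc (A : set R) (f : R -> R) (eps : R) : \bar R :=
  (\int[@lebesgue_measure R]_(tau in A `&` [set tau | (eps < `|tau|)%R])
     (f tau)%:E)%E.

Definition pv_integral (A : set R) (f : R -> R) : \bar R :=
  lim (pv_trunc A f eps @[eps --> 0^'+]).

Definition Lambda1 s u x : \bar R :=
  ereal_inf [set pv_integral setT (incr_quot s u x theta) |
             theta in esphere].

(* Every principal value exists in [-oo, +oo]. *)
Definition Lambda1_defined s u x :=
  forall theta, esphere theta ->
    cvg (pv_trunc setT (incr_quot s u x theta) eps @[eps --> 0^'+]).

(* Measurability of Lambda1 s u0 on Omega is not required: it is automatic for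
   u0 continuous. *)
Definition Lambda1_Linfty s u0 (Omega : set 'rV[R]_N) :=
  exists M : R, lebesgue_null [set x | Omega x /\
    ~ (Lambda1_defined s u0 x /\ (`|Lambda1 s u0 x| <= M%:E)%E)].

Definition sym_itv delta : set R := `](- delta), delta[.

Definition Lambda1_test s delta phi u x : \bar R :=
  ereal_inf [set (pv_integral (sym_itv delta) (incr_quot s phi x theta) +
                  \int[@lebesgue_measure R]_(tau in ~` sym_itv delta)
                    (incr_quot s u x theta tau)%:E)%E |
             theta in esphere].

End Operator.

Section Elliptic.
Context {R : realType} {N : nat}.
Context (s : R) (Omega : set 'rV[R]_N) (f g : 'rV[R]_N -> R).
Implicit Types u : 'rV[R]_N -> R.

Definition elliptic_subsolution u :=
  [/\ [bounded u x | x in setT],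
      upper_semicontinuous u,
      forall x, ~ Omega x -> u x <= g x &
      forall (phi : 'rV[R]_N -> R) x0 (delta : R),
        smooth phi -> 0 < delta -> Omega x0 -> eball x0 delta `<=` Omega ->
        (forall x, eball x0 delta x -> u x - phi x <= u x0 - phi x0) ->
        (- Lambda1_test s delta phi u x0 <= (f x0)%:E)%E].

Definition elliptic_supersolution u :=
  [/\ [bounded u x | x in setT],
      lower_semicontinuous (fun x => (u x)%:E),
      forall x, ~ Omega x -> g x <= u x &
      forall (phi : 'rV[R]_N -> R) x0 (delta : R),
        smooth phi -> 0 < delta -> Omega x0 -> eball x0 delta `<=` Omega ->
        (forall x, eball x0 delta x -> u x0 - phi x0 <= u x - phi x) ->
        ((f x0)%:E <= - Lambda1_test s delta phi u x0)%E].

Definition elliptic_solution u :=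
  elliptic_subsolution u /\ elliptic_supersolution u.

End Elliptic.

Definition first_eigenvalue {R : realType} {N : nat} (s : R)
    (Omega : set 'rV[R]_N) (mu1 : R) :=
  0 < mu1 /\
  exists phi1 : 'rV[R]_N -> R,
    [/\ continuous phi1,
        forall x, Omega x -> phi1 x < 0 &
        elliptic_solution s Omega (fun x => mu1 * phi1 x) (fun=> 0) phi1].

Section Evolution.
Context {R : realType} {N : nat}.
Context (s : R) (Omega : set 'rV[R]_N) (g u0 : 'rV[R]_N -> R).
Implicit Types (u : 'rV[R]_N * R -> R) (T : R).

(* A function on R^N x I is represented by a function on R^N x R of which only
   the restriction to R^N x I matters; the semicontinuity and continuity
   conditions below use the subspace topology. *)
Definition slab T : set ('rV[R]_N * R) := [set p | 0 <= p.2 <= T].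
Definition half_space : set ('rV[R]_N * R) := [set p | 0 <= p.2].

Definition cylinder (x0 : 'rV[R]_N) (t0 delta : R) : set ('rV[R]_N * R) :=
  eball x0 delta `*` `](t0 - delta), (t0 + delta)[.

Definition evolution_subsolution_on T u :=
  [/\ [bounded u p | p in slab T],
      upper_semicontinuous (u : subspace (slab T) -> R),
      forall x t, ~ Omega x -> 0 <= t < T -> u (x, t) <= g x,
      forall x, Omega x -> u (x, 0) <= u0 x &
      forall (phi : 'rV[R]_N * R -> R) x0 t0 (delta : R),
        smooth phi -> 0 < delta -> Omega x0 -> 0 < t0 < T ->
        cylinder x0 t0 delta `<=` Omega `*` `]0, T[ ->
        (forall p, cylinder x0 t0 delta p ->
           u p - phi p <= u (x0, t0) - phi (x0, t0)) ->
        ((derive1 (fun t => phi (x0, t)) t0)%:E -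
           Lambda1_test s delta (fun x => phi (x, t0)) (fun x => u (x, t0)) x0
         <= 0)%E].

Definition evolution_supersolution_on T u :=
  [/\ [bounded u p | p in slab T],
      lower_semicontinuous ((fun p => (u p)%:E) : subspace (slab T) -> \bar R),
      forall x t, ~ Omega x -> 0 <= t < T -> g x <= u (x, t),
      forall x, Omega x -> u0 x <= u (x, 0) &
      forall (phi : 'rV[R]_N * R -> R) x0 t0 (delta : R),
        smooth phi -> 0 < delta -> Omega x0 -> 0 < t0 < T ->
        cylinder x0 t0 delta `<=` Omega `*` `]0, T[ ->
        (forall p, cylinder x0 t0 delta p ->
           u (x0, t0) - phi (x0, t0) <= u p - phi p) ->
        (0 <= (derive1 (fun t => phi (x0, t)) t0)%:E -
           Lambda1_test s delta (fun x => phi (x, t0)) (fun x => u (x, t0)) x0)%E].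

Definition evolution_subsolution u :=
  [/\ [bounded u p | p in half_space],
      upper_semicontinuous (u : subspace half_space -> R) &
      forall T, 0 < T -> evolution_subsolution_on T u].

Definition evolution_supersolution u :=
  [/\ [bounded u p | p in half_space],
      lower_semicontinuous
        ((fun p => (u p)%:E) : subspace half_space -> \bar R) &
      forall T, 0 < T -> evolution_supersolution_on T u].

Definition evolution_solution u :=
  [/\ {within half_space, continuous u},
      evolution_subsolution u & evolution_supersolution u].

Definition admissible_data :=
  [/\ continuous u0,
      Lambda1_Linfty s u0 Omega,
      {within ~` Omega, continuous g},
      [bounded g x | x in ~` Omega] &
      forall x, ~ Omega x -> u0 x = g x].

End Evolution.

(* Main.v *)
Require Import Defs.
From HB Require Import structures.
From mathcomp Require Import all_boot all_order all_algebra.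
From mathcomp Require Import all_classical all_reals all_analysis.
From mathcomp Require Import measurable_realfun.
From mathcomp Require Import ring lra.
Import Order.TTheory GRing.Theory Num.Theory.
Import numFieldNormedType.Exports.
Local Open Scope classical_set_scope.
Local Open Scope ring_scope.
Set Implicit Arguments.
Unset Strict Implicit.
Unset Printing Implicit Defensive.

(** The theorem rests on two consequences of the infimum over directions.

If [w] is bounded, the infimum defining the operator at [z + w] exceeds the one
at [z] by at most the supremum over directions of the integral of [w].  Take
for [w] a constant [C] on the domain and [0] outside: in every direction a line
through a point of the bounded domain leaves it for good after a length [D], so
each directional integral of [w] is at most [- m C] with [m] a part of the mass
of the kernel beyond [D].  Hence [z + C exp(- m t)] on the domain, [z] outside,
is a supersolution; likewise [z - C exp(- m t)] is a subsolution, and the solution of the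
evolution problem stays between them.  This is the first part.  It also shows
that [|z| <= sup |u0|], because the evolution stays in [[- sup |u0|, sup |u0|]]
and converges to [z]; so [C] can be chosen from [u0] alone.

For the upper bound of the second part, only one good direction is needed.  The
gaussian [exp(- a |x|^2)] restricted to a line through [x] orthogonal to [x] is
[exp(- a |x|^2) exp(- a tau^2)], whose increments integrate against the kernel,
by scaling, to at most [- H a^s exp(- a |x|^2)].  So [exp(- H a^s t) exp(- a |x|^2)]
is a positive supersolution for every [a].  For the lower bound, a large
multiple of [exp(- mu1 t) phi1] lies below [u0], because the support of [u0] is
a compact subset of the domain, on which [phi1] is bounded away from zero.

Everything therefore reduces to comparing the evolution with a separated
function [W exp(- l t) h(x)], where [h] solves an elliptic inequality with right
hand side [l h], up to a barrier [C exp(- m t)]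
([evolution_le_separated], [separated_le_evolution]).  As both sides are
viscosity solutions, this is done by doubling the space variable
([doubling_comparison]).  At a maximum [(p, q, t)] of
[U(x,t) - V(y,t) - C exp(- m t) - gam t - c |x - y|^2] a translation of both
points by the same [tau theta] does not change [|x - y|], so the increments of
[U] at [p] are below those of [V] at [q] in every direction; the paraboloids
contribute nothing as the radius of the tested ball tends to [0]
([nonlocal_gap]).  One function of the pair is separated, so its time derivative
is explicit and a single time variable suffices.  As the exterior datum is only continuous and
bounded, the comparison of increments is available on bounded sets only; the
rest of the line is absorbed in the penalization [gam t]. *)

(** * The kernel and its masses *)
Section Kernel.
Context {R : realType} (s : R).
Context (hs : 1 / 2 < s < 1).
Local Notation mu := (@lebesgue_measure R).

Definition kern (tau : R) : R := (`|tau| `^ (1 + 2 * s))^-1.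

Let s0 : 0 < s. Proof. by case/andP: hs; lra. Qed.

Lemma kern_ge0 tau : 0 <= kern tau.
Proof. by rewrite /kern invr_ge0 powR_ge0. Qed.

Lemma kernN tau : kern (- tau) = kern tau.
Proof. by rewrite /kern normrN. Qed.

Lemma kernE tau : 0 < tau -> kern tau = tau `^ (- (1 + 2 * s)).
Proof. by move=> t0; rewrite /kern gtr0_norm// powRN. Qed.

Lemma measurable_kern : measurable_fun setT kern.
Proof.
rewrite (_ : kern = (fun t => (`|t| `^ (- (1 + 2 * s))))); last first.
  by apply/funext => t; rewrite powRN.
apply: (measurableT_comp (measurable_powR _)) => //.
Qed.

Lemma powR_cvgy0 (p : R) : p < 0 -> x `^ p @[x --> +oo] --> (0 : R).
Proof.
move=> p0; apply/cvgrPdist_le => /= e e0; near=> x.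
rewrite sub0r normrN ger0_norm ?powR_ge0//.
have x0 : 0 < x by near: x; apply: nbhs_pinfty_gt; rewrite num_real.
have xe : e `^ (p^-1) <= x by near: x; apply: nbhs_pinfty_ge; rewrite num_real.
have := @ge0_ler_powR _ (- p) (ltW _) (e `^ p^-1) x _ _ xe.
rewrite oppr_gt0 !nnegrE => /(_ p0 (powR_ge0 _ _) (ltW x0)).
have -> : (e `^ p^-1) `^ (- p) = e^-1.
  by rewrite -powRrM mulrN mulVf ?lt_eqF// powR_inv1// ltW.
by rewrite powRN lef_pV2 ?posrE ?powR_gt0.
Unshelve. all: by end_near. Qed.

Lemma derive_powR_over (p x : R) : p != 0 -> 0 < x ->
  (fun y : R => y `^ p / p)^`()%classic x = x `^ (p - 1).
Proof.
move=> p0 x0; rewrite derive1Mr; last by apply: derivable_powR; rewrite in_itv/= x0.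
rewrite powR_derive1 ?in_itv/= ?x0//; by rewrite mulrC mulrA mulVf ?mul1r.
Qed.

Lemma derivable_powR_over (p x : R) : 0 < x -> derivable (fun y : R => y `^ p / p) x 1.
Proof.
by move=> x0; apply: derivableM => //; apply: derivable_powR; rewrite in_itv/= x0.
Qed.

Lemma half_tail (L : R) : 0 < L ->
  (\int[mu]_(tau in `[L, +oo[) (kern tau)%:E = (L `^ (- (2 * s)) / (2 * s))%:E)%E.
Proof.
move=> L0.
under eq_integral.
  move=> x; rewrite inE/= in_itv/= andbT => Lx; rewrite (kernE (lt_le_trans L0 Lx)).
  over.
have p0 : - (2 * s) < 0 by move: s0; lra.
rewrite (@ge0_continuous_FTC2y _ _ (fun y : R => y `^ (- (2 * s)) / (- (2 * s))) L 0).
- by rewrite sub0e -EFinN invrN mulrN opprK.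
- by move=> x _; exact: powR_ge0.
- apply: derivable_within_continuous => x; rewrite in_itv/= andbT => Lx.
  by apply: derivable_powR; rewrite in_itv/= (lt_le_trans L0).
- rewrite -[X in _ --> X](mul0r (- (2 * s))^-1).
  by apply: cvgMr_tmp; exact: powR_cvgy0.
- by move=> x Lx; apply: derivable_powR_over; exact: lt_trans Lx.
- have C : {for L, continuous (fun y : R => y `^ (- (2 * s)) / (- (2 * s)))}.
    apply: differentiable_continuous; apply/derivable1_diffP.
    exact: derivable_powR_over.
  by apply: cvg_at_right_filter; exact: C.
- move=> x; rewrite in_itv/= andbT => Lx.
  rewrite derive_powR_over ?lt_eqF//; last exact: lt_trans Lx.
  by congr (_ `^ _); ring.
Qed.

(** Lebesgue measure is invariant under reflection. *)
Lemma ge0_integralN (D : set R) (f : R -> \bar R) : measurable D ->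
  measurable_fun D f -> (forall x, D x -> 0 <= f x)%E ->
  (\int[mu]_(x in D) f x = \int[mu]_(x in -%R @^-1` D) f (- x)%R)%E.
Proof.
move=> mD mf f0.
rewrite -(@ge0_integral_pushforward _ _ (measurableTypeR R) (measurableTypeR R) R
  (-%R : measurableTypeR R -> measurableTypeR R) _ mu D f) //=; last first.
  by move=> x; rewrite inE; exact: f0.
by apply: eq_measure_integral => //= A mA AS; exact/esym/lebesgue_measureN.
Qed.

Lemma odd_integral0 (D : set R) (f : R -> R) : measurable D ->
  -%R @^-1` D = D -> (forall x, f (- x) = - f x) ->
  mu.-integrable D (EFin \o f) -> (\int[mu]_(x in D) (f x)%:E = 0)%E.
Proof.
move=> mD ND Nf fi; rewrite integralE.
have mf : measurable_fun D (EFin \o f) by exact: measurable_int fi.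
have -> : (\int[mu]_(x in D) (EFin \o f)^\- x = \int[mu]_(x in D) (EFin \o f)^\+ x)%E.
  rewrite ge0_integralN//; last exact: measurable_funeneg.
  rewrite ND; apply: eq_integral => x _.
  by rewrite funenegE [RHS]funeposE/= Nf opprK.
apply: subee.
by apply: integrable_fin_num => //; apply: integrable_funepos.
Qed.

Lemma even_integral (A B : set R) (f : R -> R) : measurable A -> measurable B ->
  [disjoint A & B] -> -%R @^-1` A = B ->
  measurable_fun setT f -> (forall x, 0 <= f x) -> (forall x, f (- x) = f x) ->
  (\int[mu]_(x in A `|` B) (f x)%:E = 2%:E * \int[mu]_(x in B) (f x)%:E)%E.
Proof.
move=> mA mB AB NA mf f0 ef.
have mEf D : measurable_fun D (fun x => (f x)%:E).
  by apply/measurable_EFinP; exact: measurable_funTS.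
rewrite ge0_integral_setU//; try exact: mEf; try by move=> x _; rewrite lee_fin.
rewrite [X in (X + _)%E = _]ge0_integralN//; last by move=> x _; rewrite lee_fin.
rewrite NA mule_natl mule2n; congr (_ + _)%E.
by apply: eq_integral => x _; rewrite ef.
Qed.

Lemma outer_splitE (L : R) : 0 < L -> ~` sym_itv L = `]-oo, (- L)] `|` `[L, +oo[.
Proof.
move=> L0; apply/seteqP; split => x; rewrite /sym_itv/= !in_itv/= andbT.
  by move/negP; rewrite negb_and -!leNgt => /orP[]; [left|right].
by move=> [xL|Lx]; apply/negP; rewrite negb_and -!leNgt ?xL ?Lx ?orbT.
Qed.

Lemma measurable_outer (L : R) : measurable (~` sym_itv L).
Proof. by apply: measurableC; exact: measurable_itv. Qed.

Lemma tail_mass (L : R) : 0 < L ->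
  (\int[mu]_(tau in ~` sym_itv L) (kern tau)%:E = (L `^ (- (2 * s)) / s)%:E)%E.
Proof.
move=> L0; rewrite outer_splitE// even_integral//.
- rewrite half_tail// -EFinM; congr EFin.
  by field; rewrite gt_eqF.
- apply/eqP/seteqP; split => // x; rewrite /= !in_itv/= andbT => -[xL Lx].
  by have := le_trans Lx xL; move: L0; lra.
- apply/seteqP; split => x; rewrite /= !in_itv/= andbT; lra.
- exact: measurable_kern.
- exact: kern_ge0.
- exact: kernN.
Qed.

Definition sqkern (tau : R) := tau ^+ 2 * kern tau.

Lemma sqkern_ge0 tau : 0 <= sqkern tau.
Proof. by rewrite mulr_ge0 ?sqr_ge0 ?kern_ge0. Qed.

Lemma measurable_sqkern : measurable_fun setT sqkern.
Proof. by apply: measurable_funM; [exact: measurable_funX|exact: measurable_kern]. Qed.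

Lemma sqkernE (tau : R) : 0 < tau -> sqkern tau = tau `^ ((2 - 2 * s) - 1).
Proof.
move=> t0; rewrite /sqkern kernE// -powR_mulrn ?ltW// -powRD; last first.
  by rewrite (gt_eqF t0) implybT.
by congr (_ `^ _); ring.
Qed.

Lemma half_annulus (e d : R) : 0 < e < d ->
  (\int[mu]_(tau in `]e, d[) (sqkern tau)%:E
   = ((d `^ (2 - 2 * s) - e `^ (2 - 2 * s)) / (2 - 2 * s))%:E)%E.
Proof.
move=> /andP[e0 ed].
rewrite -(@integral_itv_bndoo _ e d _ true false); last first.
  by apply/measurable_EFinP/measurable_funTS; exact: measurable_sqkern.
under eq_integral.
  move=> x; rewrite inE/= in_itv/= => /andP[ex _]; rewrite (sqkernE (lt_le_trans e0 ex)).
  over.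
have p0 : 2 - 2 * s != 0 by apply/eqP; case/andP: hs; lra.
rewrite (@continuous_FTC2 _ _ (fun y : R => y `^ (2 - 2 * s) / (2 - 2 * s)) e d)//.
- by rewrite -EFinB mulrBl.
- apply: derivable_within_continuous => x; rewrite in_itv/= => /andP[Lx _].
  by apply: derivable_powR; rewrite in_itv/= (lt_le_trans e0).
- have C x : 0 < x -> {for x, continuous (fun y : R => y `^ (2 - 2 * s) / (2 - 2 * s))}.
    move=> x0; apply: differentiable_continuous; apply/derivable1_diffP.
    exact: derivable_powR_over.
  split.
  + move=> x; rewrite in_itv/= => /andP[ex _]; apply: derivable_powR_over.
    exact: lt_trans ex.
  + by apply: cvg_at_right_filter; exact: C.
  + by apply: cvg_at_left_filter; apply: C; exact: lt_trans ed.
- move=> x; rewrite in_itv/= => /andP[ex _].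
  by rewrite derive_powR_over// (lt_trans e0).
Qed.

Definition annulus (e d : R) : set R := sym_itv d `&` [set tau | e < `|tau|].

Lemma annulusE (e d : R) : 0 < e < d ->
  annulus e d = `](- d), (- e)[ `|` `]e, d[.
Proof.
move=> /andP[e0 ed]; apply/seteqP; split => x; rewrite /annulus /sym_itv/= !in_itv/=.
  by move=> [/andP[dx xd]]; rewrite ltr_normr => /orP[?|?]; [right|left]; apply/andP; split; lra.
move=> [/andP[? ?]|/andP[? ?]]; (split; first by apply/andP; split; lra);
  by rewrite ltr_normr; apply/orP; [right + left]; lra.
Qed.

Lemma measurable_annulus e d : measurable (annulus e d).
Proof.
apply: measurableI; first exact: measurable_itv.
rewrite (_ : [set tau | _] = (@Num.norm R R) @^-1` `]e, +oo[); last first.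
  by apply/seteqP; split => x /=; rewrite in_itv/= andbT.
rewrite -[X in measurable X]setTI.
by apply: normr_measurable => //; exact: measurable_itv.
Qed.

Lemma annulus_sym e d : -%R @^-1` (annulus e d) = annulus e d.
Proof.
by apply/seteqP; split => x; rewrite /annulus /sym_itv/= !in_itv/= normrN;
  move=> [/andP[? ?] ?]; split => //; apply/andP; split; lra.
Qed.

Lemma annulus_mass (e d : R) : 0 < e < d ->
  (\int[mu]_(tau in annulus e d) (sqkern tau)%:E
   = ((d `^ (2 - 2 * s) - e `^ (2 - 2 * s)) / (1 - s))%:E)%E.
Proof.
move=> ed; rewrite annulusE// even_integral//.
- rewrite half_annulus// -EFinM; congr EFin.
  have -> : 2 - 2 * s = 2 * (1 - s) by ring.
  by field; apply/eqP; case/andP: hs; lra.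
- apply/eqP/seteqP; split => // x; rewrite /= !in_itv/= => -[/andP[? ?] /andP[? ?]].
  by case/andP: ed; lra.
- by apply/seteqP; split => x; rewrite /= !in_itv/= => /andP[? ?]; apply/andP; split; lra.
- exact: measurable_sqkern.
- exact: sqkern_ge0.
- by move=> x; rewrite /sqkern kernN sqrrN.
Qed.

(** The integral of [tau^2 |tau|^(- 1 - 2 s)] over [|tau| < d]; it is finite
because [s < 1]. *)
Definition nearmass (d : R) : R := d `^ (2 - 2 * s) / (1 - s).

Lemma integrable_annulus (e d : R) (f : R -> R) (M : R) : 0 < e < d ->
  measurable_fun setT f -> (forall x, annulus e d x -> `|f x| <= M * sqkern x) ->
  mu.-integrable (annulus e d) (EFin \o f).
Proof.
move=> ed mf fM.
apply: (@le_integrable _ _ _ mu _ (measurable_annulus e d) _ (EFin \o (fun x => M * sqkern x))).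
- by apply/measurable_EFinP/measurable_funTS.
- move=> x /fM; rewrite /= lee_fin => /le_trans; apply; exact: ler_norm.
- rewrite (_ : EFin \o _ = (fun x => M%:E * (EFin \o sqkern) x)%E)//.
  apply: integrableZl; first exact: measurable_annulus.
  apply/integrableP; split.
    by apply/measurable_EFinP/measurable_funTS; exact: measurable_sqkern.
  under eq_integral do rewrite gee0_abs ?lee_fin ?sqkern_ge0//.
  by rewrite annulus_mass// ltry.
Qed.

(** The linear term is odd, hence vanishes in every symmetric truncation; it is the
only term that is not absolutely integrable at [0]. *)
Lemma pv_quadratic (d b c : R) : 0 < d ->
  pv_integral (sym_itv d) (fun tau => (b * tau + c * tau ^+ 2) / (`|tau| `^ (1 + 2 * s)))
  = (c * nearmass d)%:E.
Proof.
move=> d0; rewrite /pv_integral.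
apply: (@cvg_lim _ (@ereal_hausdorff R)).
have H (e : R) : 0 < e < d ->
    pv_trunc (sym_itv d) (fun tau => (b * tau + c * tau ^+ 2) / (`|tau| `^ (1 + 2 * s))) e
    = (c * ((d `^ (2 - 2 * s) - e `^ (2 - 2 * s)) / (1 - s)))%:E.
  move=> ed; rewrite /pv_trunc -/(annulus e d).
  have mo : measurable_fun setT (fun tau : R => tau * kern tau).
    by apply: measurable_funM => //; exact: measurable_kern.
  have io : mu.-integrable (annulus e d) (EFin \o (fun tau : R => tau * kern tau)).
    apply: (@integrable_annulus e d _ e^-1) => // x [_ /= ex].
    rewrite normrM (ger0_norm (kern_ge0 _)) /sqkern mulrA ler_wpM2r ?kern_ge0//.
    case/andP: ed => e0 _.
    rewrite mulrC ler_pdivlMr// -(real_normK (num_real x)) expr2.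
    by rewrite ler_wpM2l// ltW.
  have isq : mu.-integrable (annulus e d) (EFin \o sqkern).
    apply: (@integrable_annulus e d _ 1) => //; first exact: measurable_sqkern.
    by move=> x _; rewrite mul1r ger0_norm// sqkern_ge0.
  transitivity (\int[mu]_(tau in annulus e d) (b%:E * (tau * kern tau)%:E + c%:E * (sqkern tau)%:E))%E.
    apply: eq_integral => x _; rewrite -!EFinM -EFinD; congr EFin.
    by rewrite /sqkern /kern; ring.
  rewrite integralD//; [| exact: measurable_annulus|..]; last 2 first.
  - by apply: integrableZl => //; exact: measurable_annulus.
  - by apply: integrableZl => //; exact: measurable_annulus.
  rewrite !integralZl//; try exact: measurable_annulus.
  rewrite annulus_mass// odd_integral0//; first by rewrite mule0 add0e EFinM.
  - exact: measurable_annulus.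
  - exact: annulus_sym.
  - by move=> x; rewrite kernN mulNr.
apply: (@cvg_trans _ ((c * ((d `^ (2 - 2 * s) - e `^ (2 - 2 * s)) / (1 - s)))%:E @[e --> 0^'+])).
  apply: near_eq_cvg; near=> e; rewrite H//; apply/andP; split.
    by near: e; exact: nbhs_right_gt.
  by near: e; exact: nbhs_right_lt.
apply: cvg_EFin; first by near=> x.
apply: cvgMl_tmp; apply: cvgMr_tmp.
rewrite -[X in _ --> X]subr0; apply: cvgB; first exact: cvg_cst.
by apply: powR_cvg0; case/andP: hs; lra.
Unshelve. all: by end_near. Qed.

Lemma nearmass_cvg0 : nearmass d @[d --> 0^'+] --> (0 : R).
Proof.
rewrite -[X in _ --> X](mul0r (1 - s)^-1); apply: cvgMr_tmp.
by apply: powR_cvg0; case/andP: hs; lra.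
Qed.

(** The mass of the kernel on [|tau| >= L], see [tail_mass]. *)
Definition tailmass (L : R) : R := L `^ (- (2 * s)) / s.

Lemma tailmass_cvg0 : tailmass L @[L --> +oo] --> (0 : R).
Proof.
rewrite -[X in _ --> X](mul0r s^-1); apply: cvgMr_tmp.
by apply: powR_cvgy0; move: s0; lra.
Qed.

Lemma tailmass_small (k L0 e : R) : 0 < e ->
  exists2 L : R, L0 < L & k * tailmass L < e.
Proof.
move=> e0.
have : k * tailmass L @[L --> +oo] --> k * 0.
  by apply: cvgMl_tmp; exact: tailmass_cvg0.
rewrite mulr0 => /cvgrPdist_lt /(_ _ e0) H.
near (pinfty_nbhs R) => L; exists L.
  by near: L; apply: nbhs_pinfty_gt; rewrite num_real.
have : `|0 - k * tailmass L| < e by near: L.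
by rewrite sub0r normrN; apply: le_lt_trans; exact: ler_norm.
Unshelve. all: by end_near. Qed.

Lemma integrable_outer (d : R) : 0 < d -> mu.-integrable (~` sym_itv d) (EFin \o kern).
Proof.
move=> d0; apply/integrableP; split.
  by apply/measurable_EFinP/measurable_funTS; exact: measurable_kern.
under eq_integral do rewrite gee0_abs ?lee_fin ?kern_ge0//.
by rewrite tail_mass// ltry.
Qed.

Lemma integrable_outerM (d M : R) (f : R -> R) : 0 < d ->
  measurable_fun setT f -> (forall x, `|f x| <= M) ->
  mu.-integrable (~` sym_itv d) (EFin \o (fun x => f x * kern x)).
Proof.
move=> d0 mf fM.
apply: (@le_integrable _ _ _ mu _ (measurable_outer d) _ (fun x => M%:E * (EFin \o kern) x)%E).
- by apply/measurable_EFinP/measurable_funTS/measurable_funM => //; exact: measurable_kern.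
- move=> x _ /=; rewrite lee_fin normrM (ger0_norm (kern_ge0 _)).
  by rewrite (le_trans _ (ler_norm _))// ler_wpM2r ?kern_ge0.
- by apply: integrableZl; [exact: measurable_outer|exact: integrable_outer].
Qed.

Definition shell (D : R) : set R := `[D, (2 * D)].

Lemma measurable_shell (D : R) : measurable (shell D).
Proof. exact: measurable_itv. Qed.

Lemma integrable_shell (D : R) : 0 < D -> mu.-integrable (shell D) (EFin \o kern).
Proof.
move=> D0; apply: (@integrableS _ _ R mu (~` sym_itv D) (shell D)).
- exact: measurable_outer.
- exact: measurable_shell.
- by rewrite outer_splitE// => x; rewrite /shell/= !in_itv/= => /andP[-> _]; right.
- exact: integrable_outer.
Qed.

(** Length times minimum of the kernel on the shell: a lower bound of its mass. *)
Definition shellmass (D : R) : R := D * kern (2 * D).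

Lemma shell_mass (D : R) : 0 < D ->
  shellmass D <= \int[mu]_(tau in shell D) kern tau.
Proof.
move=> D0.
have D2 : D < 2 * D by lra.
have -> : shellmass D = \int[mu]_(tau in shell D) (cst (kern (2 * D)) tau).
  rewrite Rintegral_cst; last exact: measurable_itv.
  have muE : mu (shell D) = D%:E.
    rewrite /shell lebesgue_measure_itv/= lte_fin D2 -EFinB; congr EFin; ring.
  by rewrite mulrC; congr (_ * _); exact/esym/(congr1 fine muE).
have ik := integrable_shell D0.
have lek x : shell D x -> kern (2 * D) <= kern x.
  rewrite /shell/= in_itv/= => /andP[Dx xD].
  have x0 : 0 < x by exact: lt_le_trans Dx.
  rewrite /kern lef_pV2 ?posrE ?powR_gt0 ?normr_gt0 ?gt_eqF//; last lra.
  rewrite ge0_ler_powR ?nnegrE//; first by move: s0; lra.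
  by rewrite !gtr0_norm//; lra.
apply: le_Rintegral => //.
- exact: measurable_itv.
- apply: (@le_integrable _ _ _ mu _ (measurable_shell D) _ _ _ _ ik).
    by apply/measurable_EFinP; exact: measurable_cst.
  by move=> x /lek; rewrite /= lee_fin !ger0_norm ?kern_ge0.
Qed.

End Kernel.

(** * Test functions *)
Section Smooth.
Context {R : realType} {V : normedModType R}.
Implicit Types (f g : V -> R).

Lemma Ck_cst k (a : R) : Ck k ((fun=> a) : V -> R).
Proof.
elim: k a => [|k IH] a /=; first by move=> x; exact: cvg_cst.
split; first by move=> x; exact: cvg_cst.
move=> v; split; first by move=> x; exact: derivable_cst.
have -> : 'D_v (fun=> a : R) = (fun=> 0 : R) :> (V -> R); last exact: IH.
by apply/funext => x; exact: derive_cst.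
Qed.

Lemma CkW k f : Ck k.+1 f -> Ck k f.
Proof.
elim: k f => [|k IH] f; first by case.
move=> [cf df]; split => // v; have [d1 d2] := df v; split => //; exact: IH.
Qed.

Lemma CkD k f g : Ck k f -> Ck k g -> Ck k (fun x => f x + g x).
Proof.
elim: k f g => [|k IH] f g; first by move=> cf cg x; exact: cvgD (cf x) (cg x).
move=> [cf df] [cg dg]; split; first by move=> x; exact: cvgD (cf x) (cg x).
move=> v; have [f1 f2] := df v; have [g1 g2] := dg v; split.
  by move=> x; exact: derivableD.
rewrite (_ : (fun x => _) = fun x => 'D_v f x + 'D_v g x); first exact: IH.
by apply/funext => x; rewrite (deriveD (f1 x) (g1 x)).
Qed.

Lemma CkM k f g : Ck k f -> Ck k g -> Ck k (fun x => f x * g x).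
Proof.
elim: k f g => [|k IH] f g; first by move=> cf cg x; exact: cvgM (cf x) (cg x).
move=> Cf Cg; have [cf df] := Cf; have [cg dg] := Cg.
split; first by move=> x; exact: cvgM (cf x) (cg x).
move=> v; have [f1 f2] := df v; have [g1 g2] := dg v; split.
  by move=> x; exact: derivableM.
rewrite (_ : (fun x => _) = fun x => f x * 'D_v g x + g x * 'D_v f x).
  by apply: CkD; apply: IH => //; exact: CkW.
by apply/funext => x; rewrite (deriveM (f1 x) (g1 x)).
Qed.

(** Reduces directional derivatives to the one-variable chain rule. *)
Lemma is_derive_line f x v (df : R) :
  is_derive x v f df <-> is_derive (0 : R) 1 (fun h : R => f (h *: v + x)) df.
Proof.
have E : (fun h : R => h^-1 *: (((fun h : R => f (h *: v + x)) \o shift 0) (h *: 1)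
            - f (0 *: v + x)))
       = (fun h : R => h^-1 *: ((f \o shift x) (h *: v) - f x)).
  by apply/funext => h /=; rewrite addr0 scale0r add0r /GRing.scale/= mulr1.
by split=> -[d1 d2]; split; move: d1 d2; rewrite /derivable /derive E.
Qed.

Lemma Ck_exp k f : Ck k f -> Ck k (fun x => expR (f x)).
Proof.
have ce f' : continuous f' -> continuous (fun x => expR (f' x)).
  by move=> cf x; apply: (@continuous_comp _ _ _ f' expR); [exact: cf|exact: continuous_expR].
elim: k f => [|k IH] f; first exact: ce.
move=> Cf; have [cf df] := Cf; split; first exact: ce.
move=> v; have [f1 f2] := df v.
have D x : is_derive x v (fun x => expR (f x)) ('D_v f x * expR (f x)).
  apply/is_derive_line.
  have /derivableP/is_derive_line H := f1 x.
  have := @is_derive1_comp R expR (fun h : R => f (h *: v + x)) 0 _ _ _ H.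
  move=> /(_ (expR (f x))); rewrite mulrC; apply.
  by have := is_derive_expR (f (0 *: v + x)); rewrite scale0r add0r.
split; first by move=> x; exact: ex_derive.
rewrite (_ : (fun x => _) = fun x => 'D_v f x * expR (f x)).
  by apply: CkM => //; apply: IH; exact: CkW.
by apply/funext => x; rewrite derive_val.
Qed.

(** The coordinates are affine, and every test function below is obtained from
them by sums, products and exponentials. *)
Lemma Ck_affine k f (c : V -> R) : continuous f ->
  (forall x v (h : R), f (x + h *: v) = f x + h * c v) -> Ck k f.
Proof.
move=> cf fa; case: k => [|k] //; split => // v.
have D x : is_derive x v f (c v).
  apply/is_derive_line; rewrite (_ : (fun h : R => _) = (fun h : R => f x + h * c v)).
    have H := is_deriveD (is_derive_cst (f x) (0 : R) 1) (is_deriveZ (c v) (is_derive_id (0 : R) 1)).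
    rewrite (_ : (fun h : R => _) = cst (f x) + c v \*: id); last first.
      by apply/funext => h; rewrite mulrC.
    by apply: (is_derive_eq H); rewrite add0r /GRing.scale/= mulr1.
  by apply/funext => h; rewrite addrC fa.
split; first by move=> x; exact: ex_derive.
rewrite (_ : (fun x => _) = fun=> c v); first exact: Ck_cst.
by apply/funext => x; rewrite derive_val.
Qed.

End Smooth.

Section TestFunctions.
Context {R : realType} {N : nat}.
Implicit Types (x q : 'rV[R]_N).

Definition sqdist x q : R := dot (x - q) (x - q).

Lemma Ck_sum {V : normedModType R} k (I : Type) (r : seq I) (F : I -> V -> R) :
  (forall i, Ck k (F i)) -> Ck k (fun x : V => \sum_(i <- r) F i x).
Proof.
move=> FC; elim: r => [|i r IH].
  rewrite (_ : (fun x : V => _) = fun=> 0); first exact: Ck_cst.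
  by apply/funext => x; rewrite big_nil.
rewrite (_ : (fun x : V => _) = fun x : V => F i x + \sum_(j <- r) F j x); first exact: CkD.
by apply/funext => x; rewrite big_cons.
Qed.

Lemma rV_coord_continuous (i : 'I_N) : continuous (fun x : 'rV[R]_N => x 0 i).
Proof. exact: coord_continuous. Qed.

Lemma smooth_sqdist q : smooth (fun x => sqdist x q).
Proof.
move=> k; rewrite /sqdist /dot; apply: Ck_sum => i.
have C : Ck k (fun x : 'rV[R]_N => (x - q) 0 i).
  apply: (@Ck_affine _ _ _ _ (fun v : 'rV[R]_N => v 0 i)).
    rewrite (_ : (fun x : 'rV[R]_N => _) = (fun x : 'rV[R]_N => x 0 i + - q 0 i)).
      by move=> x; exact: (cvgD (@rV_coord_continuous i x) (cvg_cst _)).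
    by apply/funext => x; rewrite !mxE.
  by move=> x v h; rewrite !mxE; ring.
exact: CkM.
Qed.

Lemma smooth_sqdist_fst q : smooth (fun p : 'rV[R]_N * R => sqdist p.1 q).
Proof.
move=> k; rewrite /sqdist /dot; apply: Ck_sum => i.
have C : Ck k (fun p : 'rV[R]_N * R => (p.1 - q) 0 i).
  apply: (@Ck_affine _ _ _ _ (fun v : 'rV[R]_N * R => v.1 0 i)).
    rewrite (_ : (fun p : 'rV[R]_N * R => _) = (fun p : 'rV[R]_N * R => p.1 0 i + - q 0 i)).
      move=> x; apply: cvgD; last exact: cvg_cst.
      apply: (@continuous_comp _ _ _ fst (fun y : 'rV[R]_N => y 0 i)).
        exact: cvg_fst.
      exact: rV_coord_continuous.
    by apply/funext => x; rewrite !mxE.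
  by move=> x v h; rewrite !mxE; ring.
exact: CkM.
Qed.

Lemma smooth_snd (l : R) : smooth (fun p : 'rV[R]_N * R => l * p.2).
Proof.
move=> k; apply: (@Ck_affine _ _ _ _ (fun v : 'rV[R]_N * R => l * v.2)).
  by move=> x; apply: cvgMl_tmp; exact: cvg_snd.
by move=> x v h /=; rewrite /GRing.scale/=; ring.
Qed.

(** The paraboloid comes from doubling the space variable, the two exponentials
from the separated function and from the barrier, and the linear term from the
penalization at large times. *)
Definition test_fun c q (A l B m gam : R) (p : 'rV[R]_N * R) : R :=
  c * sqdist p.1 q + (A * expR (- l * p.2) + (B * expR (- m * p.2) + gam * p.2)).

Lemma smooth_test c q A l B m gam : smooth (test_fun c q A l B m gam).
Proof.
move=> k; apply: CkD.
  by apply: CkM; [exact: Ck_cst|exact: smooth_sqdist_fst].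
apply: CkD.
  by apply: CkM; [exact: Ck_cst|apply: Ck_exp; exact: smooth_snd].
apply: CkD; last exact: smooth_snd.
by apply: CkM; [exact: Ck_cst|apply: Ck_exp; exact: smooth_snd].
Qed.

Lemma derive1_test c q A l B m gam x t :
  derive1 (fun t => test_fun c q A l B m gam (x, t)) t
  = - l * (A * expR (- l * t)) + (- m * (B * expR (- m * t)) + gam).
Proof.
rewrite derive1E /test_fun /=.
have D (k : R) : is_derive t 1 (fun t : R => k * t) k.
  have -> : (fun t : R => k * t) = (fun t => k *: t) by [].
  apply: is_derive_eq; rewrite /GRing.scale/= mulr1//.
have E (k : R) : is_derive t 1 (fun t : R => expR (k * t)) (k * expR (k * t)).
  have := @is_derive1_comp R expR (fun t : R => k * t) t _ _ (is_derive_expR _) (D k).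
  by rewrite mulrC.
have F (a k : R) : is_derive t 1 (fun t : R => a * expR (k * t)) (k * (a * expR (k * t))).
  have := is_deriveZ a (E k).
  by rewrite /GRing.scale/= mulrCA.
have Z : is_derive t 1 (fun _ : R => c * sqdist x q) 0 by exact: is_derive_cst.
have S := is_deriveD Z (is_deriveD (F A (- l)) (is_deriveD (F B (- m)) (D gam))).
by have := @derive_val _ _ _ _ _ _ _ S; rewrite add0r.
Qed.

(** On a line the paraboloid is a quadratic polynomial with leading coefficient
[1], whatever its vertex: its principal value does not depend on [q]. *)
Lemma sqdist_line x q theta (tau : R) : esphere theta ->
  sqdist (x + tau *: theta) q - sqdist x q =
  (2 * dot (x - q) theta) * tau + tau ^+ 2.
Proof.
rewrite /esphere /= => th1.
have d1 : dot theta theta = 1.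
  have h : 0 <= dot theta theta by apply: sumr_ge0 => i _; rewrite -expr2 sqr_ge0.
  by rewrite -[LHS]sqr_sqrtr// -/(enorm theta) th1 expr1n.
have -> : tau ^+ 2 = tau ^+ 2 * dot theta theta by rewrite d1 mulr1.
rewrite /sqdist /dot -sumrB mulr_sumr mulr_sumr mulr_suml -big_split/=.
by apply: eq_bigr => i _; rewrite !mxE; ring.
Qed.

End TestFunctions.

(** * Viscosity inequalities at a point *)
Section Pointwise.
Context {R : realType} (s : R) (hs : 1 / 2 < s < 1) {N : nat}.
Local Notation mu := (@lebesgue_measure R).
Implicit Types (U V : 'rV[R]_N -> R) (x p q theta : 'rV[R]_N).

Definition bounded_by (M : R) U := forall x, `|U x| <= M.

Definition far (d : R) U x theta : R :=
  \int[mu]_(tau in ~` sym_itv d) incr_quot s U x theta tau.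

(** What a paraboloid of opening [c] touching [U] from above at [p] yields: [a] is
below the operator tested at [p], in every direction and for every small radius
[d].  The vertex of the paraboloid has disappeared by [pv_quadratic]. *)
Definition sub_at U p (a c : R) := \forall d \near (0 : R)^'+,
  forall theta, esphere theta -> a <= c * nearmass s d + far d U p theta.

(** The counterpart for a paraboloid of opening [- c] touching from below.  The
infimum need not be attained, whence the slack [e]. *)
Definition super_at V q (b c : R) := \forall d \near (0 : R)^'+,
  forall e : R, 0 < e -> exists2 theta, esphere theta &
    - c * nearmass s d + far d V q theta <= b + e.

Lemma integrable_incr_quot U x theta (M d : R) : continuous U -> bounded_by M U ->
  0 < d -> mu.-integrable (~` sym_itv d) (EFin \o incr_quot s U x theta).
Proof.
move=> cU bU d0.
apply: (@integrable_outerM _ s hs d (M + M) (fun tau => U (x + tau *: theta) - U x) d0).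
- apply: measurable_funB; last exact: measurable_cst.
  apply: continuous_measurable_fun => tau.
  apply: (@continuous_comp _ _ _ (fun tau : R => x + tau *: theta) U); last exact: cU.
  apply: cvgD; first exact: cvg_cst.
  exact: (@scalel_continuous R _ theta).
- move=> tau; apply: (le_trans (ler_normB _ _)); exact: lerD.
Qed.

Lemma far_scale W U x theta (M d : R) : continuous U -> bounded_by M U ->
  0 < d -> far d (fun y => W * U y) x theta = W * far d U x theta.
Proof.
move=> cU bU d0; rewrite /far -RintegralZl//; last first.
- exact: (integrable_incr_quot x theta cU bU d0).
- exact: measurable_outer.
by apply: eq_Rintegral => tau _; rewrite /incr_quot; ring.
Qed.

Lemma sub_at_scale W U p a c (M : R) : continuous U -> bounded_by M U -> 0 <= W ->
  sub_at U p a c -> sub_at (fun y => W * U y) p (W * a) (W * c).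
Proof.
move=> cU bU W0 H; rewrite /sub_at; near=> d => theta th.
have d0 : 0 < d by near: d; exact: nbhs_right_gt.
rewrite (far_scale _ _ _ cU bU d0) -mulrA -mulrDr ler_wpM2l//.
by move: theta th; near: d.
Unshelve. all: by end_near. Qed.

Lemma super_at_scale W V q b c (M : R) : continuous V -> bounded_by M V -> 0 < W ->
  super_at V q b c -> super_at (fun y => W * V y) q (W * b) (W * c).
Proof.
move=> cV bV W0 H; rewrite /super_at; near=> d => e e0.
have d0 : 0 < d by near: d; exact: nbhs_right_gt.
have [theta th le] : exists2 theta, esphere theta &
    - c * nearmass s d + far d V q theta <= b + e / W.
  have : 0 < e / W by rewrite divr_gt0.
  by move: (e / W); near: d.
exists theta => //.
rewrite (far_scale _ _ _ cV bV d0) -mulrN -mulrA -mulrDr.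
by apply: (le_trans (ler_wpM2l (ltW W0) le)); rewrite mulrDr mulrCA mulfV ?gt_eqF// mulr1.
Unshelve. all: by end_near. Qed.

Lemma Lambda1_testE U x q (c k M d : R) (phi : 'rV[R]_N -> R) :
  continuous U -> bounded_by M U -> 0 < d ->
  (forall y, phi y = c * sqdist y q + k) ->
  Lambda1_test s d phi U x
  = ereal_inf [set (c * nearmass s d + far d U x theta)%:E | theta in esphere].
Proof.
move=> cU bU d0 phiE; rewrite /Lambda1_test; congr ereal_inf.
apply: eq_imagel => theta th.
have -> : incr_quot s phi x theta =
    (fun tau => ((c * (2 * dot (x - q) theta)) * tau + c * tau ^+ 2) / (`|tau| `^ (1 + 2 * s))).
  apply/funext => tau; rewrite /incr_quot !phiE; congr (_ / _).
  by rewrite -mulrA -mulrDr -sqdist_line//; ring.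
rewrite pv_quadratic// EFinD; congr (_ + _)%E.
rewrite /far /Rintegral fineK//.
apply: integrable_fin_num; first exact: measurable_outer.
exact: (integrable_incr_quot x theta cU bU d0).
Qed.

(** Ordered increments integrate to ordered integrals.  A strict gain [kappa] on
the shell improves the estimate; beyond [L], where nothing is known, the
increments differ by at most [4 M]. *)
Lemma far_gap U V p q theta (kappa d D L M : R) :
  continuous U -> continuous V -> bounded_by M U -> bounded_by M V ->
  0 < d -> d < D -> d < L -> 0 <= kappa ->
  (forall tau : R, `|tau| < L ->
     U (p + tau *: theta) - V (q + tau *: theta) <= U p - V q) ->
  (forall tau : R, shell D tau ->
     U (p + tau *: theta) - V (q + tau *: theta) <= U p - V q - kappa) ->
  far d U p theta - far d V q theta
  <= - kappa * shellmass s D + 4 * M * tailmass s L.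
Proof.
move=> cU cV bU bV d0 dD dL k0 near_le shell_le.
have M0 : 0 <= M by apply: le_trans (bU p).
have D0 : 0 < D by exact: lt_trans dD.
have L0 : 0 < L by exact: lt_trans dL.
have mD := measurable_outer d.
have iU := integrable_incr_quot p theta cU bU d0.
have iV := integrable_incr_quot q theta cV bV d0.
have ik := integrable_outer hs d0.
have sub1 : shell D `&` ~` sym_itv d = shell D.
  apply/setIidPl => x; rewrite /shell /sym_itv/= !in_itv/= => /andP[Dx _].
  by move=> /andP[_]; lra.
have sub2 : ~` sym_itv L `&` ~` sym_itv d = ~` sym_itv L.
  apply/setIidPl => x; rewrite /sym_itv/= !in_itv/= => H1 H2; apply: H1.
  by move/andP: H2 => [? ?]; apply/andP; split; lra.
(* The integrands of the gain and of the tail, extended by [0]. *)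
pose k1 := kern s \_ (shell D); pose k2 := kern s \_ (~` sym_itv L).
have ik1 : mu.-integrable (~` sym_itv d) (EFin \o k1).
  rewrite /k1 -restrict_EFin; apply/integrable_restrict => //.
  + exact: measurable_shell.
  + rewrite setIC sub1; exact: integrable_shell.
have ik2 : mu.-integrable (~` sym_itv d) (EFin \o k2).
  rewrite /k2 -restrict_EFin; apply/integrable_restrict => //.
  + exact: measurable_outer.
  + rewrite setIC sub2; exact: integrable_outer.
rewrite /far -RintegralB//.
pose f3 (tau : R) := - kappa * k1 tau; pose f4 (tau : R) := 4 * M * k2 tau.
have ik3 : mu.-integrable (~` sym_itv d) (EFin \o f3).
  rewrite (_ : EFin \o _ = (fun tau => (- kappa)%:E * (EFin \o k1) tau)%E)//.
  by apply: integrableZl.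
have ik4 : mu.-integrable (~` sym_itv d) (EFin \o f4).
  rewrite (_ : EFin \o _ = (fun tau => (4 * M)%:E * (EFin \o k2) tau)%E)//.
  by apply: integrableZl.
apply: (@le_trans _ _ (\int[mu]_(tau in ~` sym_itv d) (f3 tau + f4 tau))).
  apply: le_Rintegral => //.
  - rewrite (_ : EFin \o _ = ((EFin \o incr_quot s U p theta) \- (EFin \o incr_quot s V q theta))%E)//.
    by apply: integrableB.
  - rewrite (_ : EFin \o _ = ((EFin \o f3) \+ (EFin \o f4))%E)//.
    by apply: integrableD.
  move=> tau _; rewrite /incr_quot -mulrBl -/(kern s tau) /f3 /f4 /k1 /k2 !patchE.
  have kt := kern_ge0 s tau.
  set X := U _ - _ - _.
  have X4 : X <= 4 * M.
    have := bU (p + tau *: theta); have := bU p; have := bV (q + tau *: theta); have := bV q.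
    by rewrite !ler_norml => /andP[? ?] /andP[? ?] /andP[? ?] /andP[? ?]; rewrite /X; lra.
  have XL : tau \notin ~` sym_itv L -> X <= 0.
    rewrite notin_setE /= => /contrapT; rewrite /sym_itv/= in_itv/= => tL.
    have := near_le tau; rewrite ltr_norml => /(_ tL); rewrite /X; lra.
  have Xk : tau \in shell D -> X <= - kappa.
    by rewrite inE => /(shell_le _); rewrite /X; lra.
  case: ifPn => h1; case: ifPn => h2; rewrite ?mulr0 ?addr0 ?add0r.
  - rewrite -mulrDl ler_wpM2r// (le_trans (Xk h1))// lerDl mulr_ge0//.
  - by rewrite ler_wpM2r// Xk.
  - by rewrite ler_wpM2r.
  - by rewrite mulr_le0_ge0// XL.
rewrite RintegralD// /f3 /f4 !RintegralZl// /k1 /k2 -!Rintegral_mkcondr.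
rewrite setIC sub1 [in X in _ + X]setIC sub2.
apply: lerD.
  by rewrite !mulNr lerN2 ler_wpM2l// shell_mass.
by rewrite /Rintegral tail_mass.
Qed.

(** The inequality at [p] holds in all directions, hence in one that is almost
optimal at [q]; in that direction the two integrals are compared by [far_gap].
The paraboloids contribute [2 c * nearmass s d], which tends to [0] with [d]. *)
Lemma nonlocal_gap U V p q (a b c kappa D L M : R) :
  continuous U -> continuous V -> bounded_by M U -> bounded_by M V ->
  0 < D -> 0 < L -> 0 <= kappa ->
  sub_at U p a c -> super_at V q b c ->
  (forall theta tau, esphere theta -> `|tau| < L ->
     U (p + tau *: theta) - V (q + tau *: theta) <= U p - V q) ->
  (forall theta tau, esphere theta -> shell D tau ->
     U (p + tau *: theta) - V (q + tau *: theta) <= U p - V q - kappa) ->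
  a <= b - kappa * shellmass s D + 4 * M * tailmass s L.
Proof.
move=> cU cV bU bV D0 L0 k0 HU HV near_le shell_le.
apply/ler_addgt0Pr => e e0.
have e2 : 0 < e / 2 by rewrite divr_gt0.
near (0 : R)^'+ => d.
have d0 : 0 < d by near: d; exact: nbhs_right_gt.
have dD : d < D by near: d; exact: nbhs_right_lt.
have dL : d < L by near: d; exact: nbhs_right_lt.
have cn : 2 * c * nearmass s d <= e / 2.
  near: d.
  have : 2 * c * nearmass s d @[d --> 0^'+] --> 2 * c * 0.
    by apply: cvgMl_tmp; exact: nearmass_cvg0.
  rewrite mulr0 => /cvgrPdist_le /(_ _ e2); apply: filterS => d.
  by rewrite sub0r normrN; apply: le_trans; exact: ler_norm.
have [theta th le1] : exists2 theta, esphere theta &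
    - c * nearmass s d + far d V q theta <= b + e / 2.
  have Hd : forall e : R, 0 < e -> exists2 theta, esphere theta &
      - c * nearmass s d + far d V q theta <= b + e by near: d.
  exact: Hd.
have le2 : a <= c * nearmass s d + far d U p theta.
  by move: theta th {le1}; near: d.
have := far_gap cU cV bU bV d0 dD dL k0 (fun tau => near_le theta tau th)
  (fun tau => shell_le theta tau th).
move: le1 le2 cn; rewrite mulNr -mulrA.
by lra.
Unshelve. all: by end_near. Qed.

Lemma far_cst (k d : R) x theta : far d (fun=> k) x theta = 0.
Proof.
rewrite /far (_ : incr_quot _ _ _ _ = fun=> 0); last first.
  by apply/funext => tau; rewrite /incr_quot subrr mul0r.
by rewrite /Rintegral integral0.
Qed.

End Pointwise.

(** * Lengths, compactness and continuity *)
Section Geometry.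
Context {R : realType} {N : nat}.
Implicit Types (x y theta : 'rV[R]_N) (Omega : set 'rV[R]_N).

Lemma coord_le_norm x i : `|x 0 i| <= `|x|.
Proof.
rewrite [leRHS]/Num.norm /= mx_normrE.
by apply/bigmax_geP; right => /=; exists (0, i).
Qed.

Lemma norm_le_coord x (e : R) : 0 <= e -> (forall i, `|x 0 i| <= e) -> `|x| <= e.
Proof.
move=> e0 H; rewrite [leLHS]/Num.norm /= mx_normrE.
by apply/bigmax_leP; split => // -[i j] _ /=; rewrite ord1.
Qed.

Lemma dot_ge0 x : 0 <= dot x x.
Proof. by apply: sumr_ge0 => i _; rewrite -expr2 sqr_ge0. Qed.

Lemma sqr_coord_le_dot x i : (x 0 i) ^+ 2 <= dot x x.
Proof.
rewrite /dot (bigD1 i)//= expr2 lerDl; apply: sumr_ge0 => j _.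
by rewrite -expr2 sqr_ge0.
Qed.

Lemma sqr_norm_le_dot x : `|x| ^+ 2 <= dot x x.
Proof.
rewrite -(sqr_sqrtr (dot_ge0 x)) lerXn2r ?nnegrE ?sqrtr_ge0//.
apply: norm_le_coord; first exact: sqrtr_ge0.
by move=> i; rewrite -sqrtr_sqr ler_wsqrtr// sqr_coord_le_dot.
Qed.

Lemma norm_le_enorm x : `|x| <= enorm x.
Proof.
by rewrite -(ger0_norm (normr_ge0 x)) -sqrtr_sqr ler_wsqrtr// sqr_norm_le_dot.
Qed.

Lemma esphere_norm_le1 theta : esphere theta -> `|theta| <= 1.
Proof. by move=> th; rewrite -[leRHS]th norm_le_enorm. Qed.

Lemma esphere_dot theta : esphere theta -> dot theta theta = 1.
Proof. by move=> th; rewrite -[LHS]sqr_sqrtr ?dot_ge0// -/(enorm theta) th expr1n. Qed.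

Lemma esphere_norm_ge theta : esphere theta -> 1 <= N%:R * `|theta|.
Proof.
move=> th; rewrite -[leLHS](esphere_dot th) /dot.
apply: (@le_trans _ _ (\sum_(i < N) `|theta|)); last first.
  by rewrite sumr_const card_ord mulr_natl.
apply: ler_sum => i _; rewrite -expr2 -real_normK ?num_real// expr2.
rewrite -[leRHS]mul1r ler_pM//; last exact: coord_le_norm.
exact: (le_trans (coord_le_norm _ _) (esphere_norm_le1 th)).
Qed.

(** A line through a point of a bounded set leaves it for good after a length that
depends on the set only.  In the norm of ['rV_N], the maximum of the
coordinates, a Euclidean unit vector has length at least [1 / N]. *)
Lemma bounded_exit Omega (rho : R) : (forall x, Omega x -> `|x| <= rho) ->
  exists2 D : R, 0 < D & forall p theta tau, Omega p -> esphere theta ->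
    D <= `|tau| -> ~ Omega (p + tau *: theta).
Proof.
move=> Orho; exists (N%:R * (2 * `|rho| + 1) + 1).
  by rewrite ltr_pwDr// mulr_ge0// addr_ge0// mulr_ge0.
move=> p theta tau Op th Dt O'.
have h1 := Orho _ Op; have h2 := Orho _ O'.
have h3 : `|tau *: theta| <= 2 * `|rho|.
  have -> : tau *: theta = (p + tau *: theta) - p by rewrite addrC addKr.
  apply: (le_trans (ler_normB _ _)); rewrite (_ : 2 = 1 + 1)// mulrDl !mul1r.
  by apply: lerD; [apply: le_trans h2 _|apply: le_trans h1 _]; exact: ler_norm.
have h4 := esphere_norm_ge th.
have h5 : `|tau| <= N%:R * (2 * `|rho|).
  rewrite normrZ in h3.
  apply: (@le_trans _ _ (`|tau| * (N%:R * `|theta|))).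
    by rewrite -[leLHS]mulr1 ler_wpM2l.
  by rewrite mulrCA ler_wpM2l.
have := le_trans Dt h5; rewrite leNgt => /negP; apply.
by rewrite mulrDr mulr1 -addrA ltrDl ltr_pwDr.
Qed.

Lemma sqdist_translate x y v : sqdist (x + v) (y + v) = sqdist x y.
Proof. by rewrite /sqdist opprD addrACA subrr addr0. Qed.

Lemma sqdist_ge0 x y : 0 <= sqdist x y.
Proof. exact: dot_ge0. Qed.

Lemma sqdistxx x : sqdist x x = 0.
Proof. by rewrite /sqdist /dot subrr big1// => i _; rewrite mxE mul0r. Qed.

Lemma sqdistC x y : sqdist x y = sqdist y x.
Proof. by rewrite /sqdist /dot; apply: eq_bigr => i _; rewrite !mxE; ring. Qed.

Lemma eball_sub Omega x0 : open Omega -> Omega x0 ->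
  \forall d \near (0 : R)^'+, eball x0 d `<=` Omega.
Proof.
move=> oO Ox0.
have [e /= e0 eO] : exists2 e : R, 0 < e & ball x0 e `<=` Omega.
  by apply/nbhs_ballP; exact: oO.
near=> d => y; rewrite /eball /= => yd; apply: eO.
rewrite -ball_normE /= distrC (le_lt_trans (norm_le_enorm _))// (lt_trans yd)//.
Unshelve. all: by end_near. Qed.

Definition box (rho T : R) : set (('rV[R]_N * 'rV[R]_N) * R) :=
  ([set x | `|x| <= rho] `*` [set x | `|x| <= rho]) `*` `[0, T].

Lemma compact_box rho T : compact (box rho T).
Proof.
have C : compact [set x : 'rV[R]_N | `|x| <= rho].
  apply: bounded_closed_compact.
    exists rho; split; first exact: num_real.
    by move=> M rM x /= xr; rewrite (le_trans xr)// ltW.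
  rewrite (_ : [set x | _] = (@Num.norm _ 'rV[R]_N) @^-1` [set r | r <= rho])//.
  apply: closed_comp; last exact: closed_le.
  by move=> x _; exact: norm_continuous.
by apply: compact_setX; [exact: compact_setX|exact: segment_compact].
Qed.

Lemma continuous_pairing (X Y Z : topologicalType) (f : X -> Y) (g : X -> Z) :
  continuous f -> continuous g -> continuous (fun a => (f a, g a)).
Proof.
by move=> cf cg a; apply: (@cvg_pair _ _ _ (nbhs a)); [exact: cf|exact: cg].
Qed.

Lemma continuous_left (U : 'rV[R]_N * R -> R) : continuous U ->
  continuous (fun p : ('rV[R]_N * 'rV[R]_N) * R => U (p.1.1, p.2)).
Proof.
move=> cU p; apply: (@continuous_comp _ _ _
  (fun p : ('rV[R]_N * 'rV[R]_N) * R => (p.1.1, p.2)) U); last exact: cU.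
apply: continuous_pairing => [{}p|{}p]; last exact: cvg_snd.
by apply: (@continuous_comp _ _ _ fst fst); exact: cvg_fst.
Qed.

Lemma continuous_right (U : 'rV[R]_N * R -> R) : continuous U ->
  continuous (fun p : ('rV[R]_N * 'rV[R]_N) * R => U (p.1.2, p.2)).
Proof.
move=> cU p; apply: (@continuous_comp _ _ _
  (fun p : ('rV[R]_N * 'rV[R]_N) * R => (p.1.2, p.2)) U); last exact: cU.
apply: continuous_pairing => [{}p|{}p]; last exact: cvg_snd.
by apply: (@continuous_comp _ _ _ fst snd); [exact: cvg_fst|exact: cvg_snd].
Qed.

Lemma continuous_slice (U : 'rV[R]_N * R -> R) t : continuous U ->
  continuous (fun x => U (x, t)).
Proof.
move=> cU x; apply: (@continuous_comp _ _ _ (fun x => (x, t)) U); last exact: cU.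
apply: (@continuous_pairing 'rV[R]_N 'rV[R]_N R id (fun=> t)); last exact: cst_continuous.
by move=> y; exact: cvg_id.
Qed.

Lemma continuous_sqdist :
  continuous (fun p : ('rV[R]_N * 'rV[R]_N) * R => sqdist p.1.1 p.1.2).
Proof.
have C i : continuous (fun p : ('rV[R]_N * 'rV[R]_N) * R => (p.1.1 - p.1.2) 0 i).
  rewrite (_ : (fun p : ('rV[R]_N * 'rV[R]_N) * R => _) =
      (fun p : ('rV[R]_N * 'rV[R]_N) * R => p.1.1 0 i - p.1.2 0 i)); last first.
    by apply/funext => p; rewrite !mxE.
  have cc := @rV_coord_continuous R N i.
  have c1 := @continuous_left (fun p => p.1 0 i).
  have c2 := @continuous_right (fun p => p.1 0 i).
  have c0 : continuous (fun p : 'rV[R]_N * R => p.1 0 i).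
    by move=> p; apply: (@continuous_comp _ _ _ fst (fun y : 'rV[R]_N => y 0 i)); [exact: cvg_fst|exact: cc].
  by move=> p; apply: continuousB; [exact: c1|exact: c2].
(* Class C^0 is continuity. *)
rewrite /sqdist /dot; apply: (@Ck_sum _ _ 0) => i p.
by apply: continuousM; exact: C.
Qed.

(** On the compact set of triples [(x, y, t)] where the slices differ by at least
[e], the distance from [x] to [y] has a positive minimum. *)
Lemma uniform_slices (U : 'rV[R]_N * R -> R) (rho T e : R) : continuous U -> 0 < e ->
  exists2 r : R, 0 < r & forall x y t, `|x| <= rho -> `|y| <= rho -> 0 <= t <= T ->
    sqdist x y < r -> `|U (x, t) - U (y, t)| < e.
Proof.
move=> cU e0.
pose gap (p : ('rV[R]_N * 'rV[R]_N) * R) := `|U (p.1.1, p.2) - U (p.1.2, p.2)|.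
have cgap : continuous gap.
  move=> p; apply: cvg_norm.
  by apply: continuousB; [exact: continuous_left|exact: continuous_right].
pose K := box rho T `&` [set p | e <= gap p].
have cK : compact K.
  apply: compact_closedI; first exact: compact_box.
  rewrite (_ : [set p | _] = gap @^-1` [set r | e <= r])//.
  by apply: closed_comp; [move=> p _; exact: cgap|exact: closed_ge].
have [[p0 Kp0]|K0] := pselect (K !=set0); last first.
  exists 1 => // x y t xr yr tT _; rewrite ltNge; apply/negP => h.
  by apply: K0; exists ((x, y), t); split => //; split => //=; rewrite in_itv.
have [||c cK' cmin] := @compact_EVT_min _ R (fun p => sqdist p.1.1 p.1.2) K _ cK.
- by exists p0.
- by apply: continuous_subspaceT; exact: continuous_sqdist.
move: cK'; rewrite inE => -[cbox cgap'].
have h : 0 < sqdist c.1.1 c.1.2.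
  rewrite lt_neqAle sqdist_ge0 andbT eq_sym; apply/negP => /eqP h.
  have E : c.1.1 = c.1.2.
    apply/eqP; rewrite -subr_eq0 -normr_le0 -(@ler_sqr _ _ 0) ?nnegrE// expr0n/=.
    by rewrite -[leRHS]h sqr_norm_le_dot.
  by move: cgap'; rewrite /= /gap E subrr normr0 leNgt e0.
exists (sqdist c.1.1 c.1.2) => // x y t xr yr tT xy; rewrite ltNge; apply/negP => h'.
have := cmin ((x, y), t).
rewrite inE => /(_ (conj (conj (conj xr yr) _) h')).
rewrite /= in_itv => /(_ tT).
by rewrite leNgt xy.
Qed.

End Geometry.

(** * Comparison by doubling the space variable *)
Section Doubling.
Context {R : realType} (s : R) (hs : 1 / 2 < s < 1) {N : nat}.
Context (Omega : set 'rV[R]_N) (rho0 D : R).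
Context (Orho : forall x, Omega x -> `|x| <= rho0) (D0 : 0 < D)
  (exitD : forall p theta tau, Omega p -> esphere theta -> D <= `|tau| ->
     ~ Omega (p + tau *: theta)).
Context (U V : 'rV[R]_N * R -> R) (M C m : R).

Definition doubled (c gam : R) (x y : 'rV[R]_N) (t : R) : R :=
  U (x, t) - V (y, t) - C * expR (- m * t) - gam * t - c * sqdist x y.

Lemma continuous_doubled (c gam : R) : continuous U -> continuous V ->
  continuous (fun z : ('rV[R]_N * 'rV[R]_N) * R => doubled c gam z.1.1 z.1.2 z.2).
Proof.
move=> cU cV.
pose X := (('rV[R]_N * 'rV[R]_N) * R)%type.
have cB (f g : X -> R) : continuous f -> continuous g -> continuous (fun z => f z - g z).
  by move=> cf cg z; apply: continuousB; [exact: cf|exact: cg].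
have cM (k : R) (f : X -> R) : continuous f -> continuous (fun z => k * f z).
  by move=> cf z; apply: cvgMl_tmp; exact: cf.
have c2 : continuous (fun z : X => z.2) by move=> z; exact: cvg_snd.
apply: (cB (fun z => _) (fun z => c * sqdist z.1.1 z.1.2)); last exact/cM/continuous_sqdist.
apply: (cB (fun z => _) (fun z => gam * z.2)); last exact: cM.
apply: (cB (fun z => _) (fun z => C * expR (- m * z.2))).
  by apply: cB; [exact: continuous_left|exact: continuous_right].
have c3 := cM (- m) _ c2.
apply: cM => z; apply: (@continuous_comp _ _ _ (fun z : X => - m * z.2) expR); first exact: c3.
exact: continuous_expR.
Qed.

(** If [U] exceeds [V] plus the barrier somewhere, the doubled function has a
positive maximum.  For [c] large the maximum point has [p] and [q] so close that
the exterior inequality [U <= V] forces both into [Omega], forces [t > 0], and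
controls, within length [L], the translated pairs that leave [Omega].  On the
shell both translated points are outside, which gains the full barrier
[C exp(- m t)] and pays for its time derivative. *)
Theorem doubling_comparison :
  continuous U -> continuous V -> (forall p, `|U p| <= M) -> (forall p, `|V p| <= M) ->
  0 <= C -> m <= shellmass s D ->
  (forall x t, ~ Omega x -> 0 <= t -> U (x, t) <= V (x, t)) ->
  (forall x, Omega x -> U (x, 0) <= V (x, 0) + C) ->
  (forall c gam p q t, 0 < c -> 0 < gam -> Omega p -> Omega q -> 0 < t ->
     (forall x y r, Omega x -> Omega y -> 0 < r ->
        doubled c gam x y r <= doubled c gam p q t) ->
     exists a b, [/\ sub_at s (fun x => U (x, t)) p a c,
       super_at s (fun y => V (y, t)) q b c &
       gam - m * (C * expR (- m * t)) <= a - b]) ->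
  forall x t, 0 <= t -> U (x, t) <= V (x, t) + C * expR (- m * t).
Proof.
move=> cU cV bU bV C0 mD out init key x1 t1 t10.
have beta0 t : 0 <= C * expR (- m * t) by rewrite mulr_ge0// expR_ge0.
have [Ox1|nOx1] := pselect (Omega x1); last first.
  by apply: (le_trans (out _ _ nOx1 t10)); rewrite lerDl.
rewrite leNgt; apply/negP => lt1.
set G := U (x1, t1) - V (x1, t1) - C * expR (- m * t1).
have G0 : 0 < G by rewrite /G; lra.
pose gam := G / (2 * (t1 + 1)).
have t11 : 0 < 2 * (t1 + 1) by lra.
have gam0 : 0 < gam by rewrite divr_gt0.
(* With this slope the penalization spends at most half of the gap [G] at
   [(x1, t1)]; the other half [m0] is what every later error must stay below. *)
pose m0 := G / 2.
have m00 : 0 < m0 by rewrite divr_gt0.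
have Gm0 : m0 <= G - gam * t1.
  have E : gam * (2 * (t1 + 1)) = G by rewrite divfK// gt_eqF.
  by rewrite /m0; move: gam0; lra.
have M0 : 0 <= M by apply: le_trans (bU (x1, t1)).
have UV2 x y t : U (x, t) - V (y, t) <= 2 * M.
  have := bU (x, t); have := bV (y, t).
  by rewrite !ler_norml => /andP[? ?] /andP[? ?]; lra.
pose T := 2 * M / gam.
have gT t : T < t -> 2 * M < gam * t.
  by move=> Tt; rewrite [ltRHS]mulrC -ltr_pdivrMr.
(* Beyond [L] the crude bound on the increments costs less than [gam]. *)
have [L L0 tailL] := tailmass_small hs (4 * M) 0 gam0.
(* All translates by at most [L] or along the shell stay in this ball. *)
pose rho := rho0 + L + 2 * D.
have [rU rU0 unifU] := @uniform_slices _ _ U rho T m0 cU m00.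
have [rV rV0 unifV] := @uniform_slices _ _ V rho T m0 cV m00.
pose r := Num.min rU rV.
have r0 : 0 < r by rewrite lt_min rU0.
(* The penalized gap is at most [2 M], so this [c] forces [|p - q|^2 < r]. *)
pose c := (2 * M + 1) / r.
have c0 : 0 < c by rewrite divr_gt0//; lra.
have T0 : t1 <= T.
  rewrite leNgt; apply/negP => /gT; have := UV2 x1 x1 t1; have := beta0 t1.
  by move: Gm0 m00; rewrite /G; lra.
pose F (z : ('rV[R]_N * 'rV[R]_N) * R) := doubled c gam z.1.1 z.1.2 z.2.
have cF : continuous F by exact: continuous_doubled.
have F1 : m0 <= doubled c gam x1 x1 t1.
  by move: Gm0; rewrite /doubled sqdistxx mulr0 subr0.
have [||[[p q] t]] := @compact_EVT_max _ R F _ _ (@compact_box R N rho0 T).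
- exists ((x1, x1), t1); split; first by split; exact: Orho.
  by rewrite /= in_itv/= t10 T0.
- exact: continuous_subspaceT.
rewrite inE => -[[/= pr qr]]; rewrite in_itv/= => /andP[t0 tT] Fmax.
have Fle x y r' : `|x| <= rho0 -> `|y| <= rho0 -> 0 <= r' ->
    doubled c gam x y r' <= doubled c gam p q t.
  move=> xr yr r'0; have [r'T|r'T] := leP r' T.
    apply: (Fmax ((x, y), r')); rewrite inE; split => //=.
    by rewrite in_itv/= r'0 r'T.
  have Fpq : m0 <= doubled c gam p q t.
    apply: (le_trans F1); apply: (Fmax ((x1, x1), t1)); rewrite inE.
    by split; [split; exact: Orho|rewrite /= in_itv/= t10 T0].
  apply: le_trans Fpq; apply: le_trans (ltW m00).
  have := gT _ r'T; have := UV2 x y r'; have := beta0 r'.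
  have : 0 <= c * sqdist x y by rewrite mulr_ge0 ?sqdist_ge0// ltW.
  by rewrite /doubled; lra.
have Fpq : m0 <= doubled c gam p q t.
  by apply: (le_trans F1); apply: Fle => //; exact: Orho.
have cpq0 : 0 <= c * sqdist p q by rewrite mulr_ge0 ?sqdist_ge0// ltW.
have gt0 : 0 <= gam * t by rewrite mulr_ge0// ltW.
have UVpq : m0 <= U (p, t) - V (q, t) - C * expR (- m * t).
  by move: Fpq; rewrite /doubled; lra.
have spq : sqdist p q < r.
  rewrite -(ltr_pM2l c0) [ltRHS]mulrC mulrCA mulfV ?gt_eqF// mulr1.
  have := UV2 p q t; have := beta0 t; move: Fpq; rewrite /doubled; lra.
(* If one of the two points is outside, [U <= V] there and uniform continuity
   moves the other point to it. *)
have off x y : `|x| <= rho -> `|y| <= rho -> sqdist x y = sqdist p q ->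
    ~ (Omega x /\ Omega y) -> U (x, t) - V (y, t) < m0.
  move=> xr yr xy nO.
  have tT' : 0 <= t <= T by rewrite t0.
  have /andP[sU sV] : (sqdist x y < rU) && (sqdist x y < rV).
    by rewrite -lt_min xy.
  have := unifU x y t xr yr tT' sU; have := unifV x y t xr yr tT' sV.
  rewrite !ltr_norml => /andP[? ?] /andP[? ?].
  have [Ox|nOx] := pselect (Omega x).
    have := out y t (fun Oy => nO (conj Ox Oy)) t0; lra.
  have := out x t nOx t0; lra.
have rr : rho0 <= rho by rewrite /rho -addrA lerDl; move: D0 L0; lra.
have [Op Oq] : Omega p /\ Omega q.
  apply: contrapT => nO.
  have := off p q (le_trans pr rr) (le_trans qr rr) erefl nO.
  by have := beta0 t; move: UVpq; lra.
have tp : 0 < t.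
  rewrite lt_neqAle t0 andbT; apply/negP => /eqP t0'.
  have Tpos : (0 : R) <= 0 <= T by rewrite lexx (le_trans t10 T0).
  have := unifV p q 0 (le_trans pr rr) (le_trans qr rr) Tpos.
  have : sqdist p q < rV by move: spq; rewrite lt_min => /andP[].
  move=> h /(_ h); rewrite ltr_norml => /andP[? ?].
  have := init p Op; move: UVpq; rewrite -t0' mulr0 expR0 mulr1; lra.
have [a [b [subU superV ab]]] := key c gam p q t c0 gam0 Op Oq tp
  (fun x y r' Ox Oy r'0 => Fle x y r' (Orho Ox) (Orho Oy) (ltW r'0)).
have trans_norm (z theta : 'rV[R]_N) (tau K : R) : `|z| <= rho0 -> esphere theta -> `|tau| <= K ->
    rho0 + K <= rho -> `|z + tau *: theta| <= rho.
  move=> zr th tK Kr; apply: le_trans Kr; apply: (le_trans (ler_normD _ _)).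
  apply: lerD => //; rewrite normrZ (le_trans _ tK)// -[leRHS]mulr1.
  by rewrite ler_wpM2l// esphere_norm_le1.
have gap := @nonlocal_gap _ s hs N (fun x => U (x, t)) (fun y => V (y, t)) p q a b c
  (C * expR (- m * t)) D L M (continuous_slice cU) (continuous_slice cV)
  (fun x => bU (x, t)) (fun x => bV (x, t)) D0 L0 (beta0 t) subU superV.
have {}gap : a <= b - C * expR (- m * t) * shellmass s D + 4 * M * tailmass s L.
  apply: gap => theta tau th ht.
    have [[Ox Oy]|nO] := pselect (Omega (p + tau *: theta) /\ Omega (q + tau *: theta)).
      have := Fle _ _ t (Orho Ox) (Orho Oy) t0.
      by rewrite /doubled sqdist_translate; lra.
    have KL : rho0 + L <= rho by rewrite /rho lerDl; move: D0; lra.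
    have := off _ _ (trans_norm _ _ _ _ pr th (ltW ht) KL) (trans_norm _ _ _ _ qr th (ltW ht) KL)
      (sqdist_translate _ _ _) nO.
    by have := beta0 t; move: UVpq; lra.
  move: ht; rewrite /shell/= in_itv/= => /andP[Dt tD].
  have tau0 : 0 <= tau by move: D0; lra.
  have KL : rho0 + 2 * D <= rho by rewrite /rho lerD2r lerDl ltW.
  have tK : `|tau| <= 2 * D by rewrite ger0_norm.
  have nO : ~ (Omega (p + tau *: theta) /\ Omega (q + tau *: theta)).
    by move=> [Ox _]; apply: exitD Ox => //; rewrite ger0_norm.
  have := off _ _ (trans_norm _ _ _ _ pr th tK KL) (trans_norm _ _ _ _ qr th tK KL)
    (sqdist_translate _ _ _) nO.
  by move: UVpq; lra.
have : 0 <= C * expR (- m * t) * (shellmass s D - m) by rewrite mulr_ge0// subr_ge0.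
by move: ab gap tailL; lra.
Qed.

End Doubling.

(** * From viscosity solutions to pointwise inequalities *)
Section Evolution.
Context {R : realType} (s : R) (hs : 1 / 2 < s < 1) {N : nat}.
Context (Omega : set 'rV[R]_N) (oOmega : open Omega).
Implicit Types (g h : 'rV[R]_N -> R).

(** Turns continuity on the closed half space into continuity everywhere, so that
compactness arguments need no relative topology. *)
Definition even_ext (u : 'rV[R]_N * R -> R) (p : 'rV[R]_N * R) : R := u (p.1, `|p.2|).

Lemma continuous_even_ext u : {within half_space, continuous u} ->
  continuous (even_ext u).
Proof.
move=> /subspace_continuousP cu p.
have H : half_space (p.1, `|p.2|) by rewrite /half_space /=.
have cm : continuous (fun p : 'rV[R]_N * R => (p.1, `|p.2|)).
  apply: (@continuous_pairing _ _ _ fst (fun p : 'rV[R]_N * R => `|p.2|)) => z.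
    exact: cvg_fst.
  by apply: cvg_norm; exact: cvg_snd.
have H' : (fun p : 'rV[R]_N * R => (p.1, `|p.2|)) @ p --> within half_space (nbhs (p.1, `|p.2|)).
  move=> A wA; have := cm p _ wA; rewrite /nbhs/=.
  by apply: filterS => z; apply; rewrite /half_space /=.
exact: (cvg_comp _ _ H' (cu _ H)).
Qed.

Lemma bounded_on_bound (T : Type) (V : normedModType R) (f : T -> V) (A : set T) : [bounded f x | x in A] ->
  exists M : R, forall x, A x -> `|f x| <= M.
Proof.
move=> H; near (pinfty_nbhs R) => M; exists M => x Ax.
by move: x Ax; near: M; exact: H.
Unshelve. all: by end_near. Qed.

Lemma evolution_solution_data g u0 u : evolution_solution s Omega g u0 u ->
  [/\ continuous (even_ext u), exists M : R, forall p, `|even_ext u p| <= M,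
      forall x t, ~ Omega x -> 0 <= t -> u (x, t) = g x &
      forall x, Omega x -> u (x, 0) = u0 x].
Proof.
move=> [cu [bu _ sub] [_ _ sup]]; split.
- exact: continuous_even_ext.
- have [M HM] := bounded_on_bound bu; exists M => p; apply: HM.
  by rewrite /half_space /=.
- move=> x t nO t0.
  have T0 : 0 < t + 1 by rewrite ltr_pwDr.
  have tT : 0 <= t < t + 1 by rewrite t0 ltrDl ltr01.
  have [_ _ h1 _ _] := sub _ T0; have [_ _ h2 _ _] := sup _ T0.
  by apply/eqP; rewrite eq_le h1// h2.
- move=> x Ox.
  have [_ _ _ h1 _] := sub _ ltr01; have [_ _ _ h2 _] := sup _ ltr01.
  by apply/eqP; rewrite eq_le h1// h2.
Qed.

Lemma even_extE u x (t : R) : 0 <= t -> even_ext u (x, t) = u (x, t).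
Proof. by move=> t0; rewrite /even_ext /= ger0_norm. Qed.

Lemma even_ext_slice u (t : R) : 0 <= t -> (fun x => even_ext u (x, t)) = (fun x => u (x, t)).
Proof. by move=> t0; apply/funext => x; exact: even_extE. Qed.

Lemma cylinder_sub x0 t0 (d : R) : eball x0 d `<=` Omega -> d < t0 -> d < 1 ->
  cylinder x0 t0 d `<=` Omega `*` `]0, (t0 + 1)[.
Proof.
move=> dO dt d1 [x t] [/= xd]; rewrite in_itv/= => /andP[? ?]; split; first exact: dO.
by rewrite /= in_itv/=; apply/andP; split; lra.
Qed.

(** The test function touches [u] on all of [Omega], so the tested ball may be
chosen as small as desired; [t0 + 1] serves as final time. *)
Lemma evolution_sub_at g u0 u x0 t0 c q A l B m gam :
  evolution_solution s Omega g u0 u -> Omega x0 -> 0 < t0 ->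
  (forall x t, Omega x -> 0 < t ->
     u (x, t) - test_fun c q A l B m gam (x, t) <= u (x0, t0) - test_fun c q A l B m gam (x0, t0)) ->
  sub_at s (fun x => u (x, t0)) x0
    (- l * (A * expR (- l * t0)) + (- m * (B * expR (- m * t0)) + gam)) c.
Proof.
move=> su Ox0 t00 umax.
have [cu [M bu] _ _] := evolution_solution_data su.
have cut : continuous (fun x => u (x, t0)).
  by rewrite -even_ext_slice ?ltW//; exact: continuous_slice.
have but : bounded_by M (fun x => u (x, t0)).
  by move=> x; have := bu (x, t0); rewrite /even_ext /= (gtr0_norm t00).
rewrite /sub_at; near=> d => theta th.
have d0 : 0 < d by near: d; exact: nbhs_right_gt.
have dt : d < t0 by near: d; exact: nbhs_right_lt.
have d1 : d < 1 by near: d; exact: nbhs_right_lt.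
have dO : eball x0 d `<=` Omega by near: d; exact: eball_sub.
have [_ [_ _ sub] _] := su.
have T0 : 0 < t0 + 1 by rewrite ltr_pwDr// ltW.
have cyl := cylinder_sub dO dt d1.
have tT : 0 < t0 < t0 + 1 by rewrite t00 ltrDl ltr01.
have [_ _ _ _ /(_ _ x0 t0 d (smooth_test c q A l B m gam) d0 Ox0 tT cyl)] := sub _ T0.
have max' p : cylinder x0 t0 d p ->
    u p - test_fun c q A l B m gam p <= u (x0, t0) - test_fun c q A l B m gam (x0, t0).
  by case: p => x t /cyl [/= Ox]; rewrite in_itv/= => /andP[t_gt0 _]; exact: umax.
move=> /(_ max'); rewrite derive1_test sube_le0.
rewrite (@Lambda1_testE _ s hs N _ x0 q c
  (A * expR (- l * t0) + (B * expR (- m * t0) + gam * t0)) M d)//.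
by move=> /le_trans/(_ (ereal_inf_lbound (imageP _ th))); rewrite lee_fin.
Unshelve. all: by end_near. Qed.

Lemma inf_witness (F : 'rV[R]_N -> R) (b e : R) : 0 < e ->
  (ereal_inf [set (F theta)%:E | theta in esphere] <= b%:E)%E ->
  exists2 theta, esphere theta & F theta <= b + e.
Proof.
move=> e0 H.
have : (ereal_inf [set (F theta)%:E | theta in esphere] < (b + e)%:E)%E.
  by apply: le_lt_trans H _; rewrite lte_fin ltrDl.
by move=> /ereal_inf_lt [_ [theta th <-]]; rewrite lte_fin => /ltW; exists theta.
Qed.

Lemma evolution_super_at g u0 u x0 t0 c q A l B m gam :
  evolution_solution s Omega g u0 u -> Omega x0 -> 0 < t0 ->
  (forall x t, Omega x -> 0 < t ->
     u (x0, t0) - test_fun (- c) q A l B m gam (x0, t0) <= u (x, t) - test_fun (- c) q A l B m gam (x, t)) ->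
  super_at s (fun x => u (x, t0)) x0
    (- l * (A * expR (- l * t0)) + (- m * (B * expR (- m * t0)) + gam)) c.
Proof.
move=> su Ox0 t00 umin.
have [cu [M bu] _ _] := evolution_solution_data su.
have cut : continuous (fun x => u (x, t0)).
  by rewrite -even_ext_slice ?ltW//; exact: continuous_slice.
have but : bounded_by M (fun x => u (x, t0)).
  by move=> x; have := bu (x, t0); rewrite /even_ext /= (gtr0_norm t00).
rewrite /super_at; near=> d => e e0.
have d0 : 0 < d by near: d; exact: nbhs_right_gt.
have dt : d < t0 by near: d; exact: nbhs_right_lt.
have d1 : d < 1 by near: d; exact: nbhs_right_lt.
have dO : eball x0 d `<=` Omega by near: d; exact: eball_sub.
have [_ _ [_ _ sup]] := su.
have T0 : 0 < t0 + 1 by rewrite ltr_pwDr// ltW.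
have cyl := cylinder_sub dO dt d1.
have tT : 0 < t0 < t0 + 1 by rewrite t00 ltrDl ltr01.
have [_ _ _ _ /(_ _ x0 t0 d (smooth_test (- c) q A l B m gam) d0 Ox0 tT cyl)] := sup _ T0.
have min' p : cylinder x0 t0 d p ->
    u (x0, t0) - test_fun (- c) q A l B m gam (x0, t0) <= u p - test_fun (- c) q A l B m gam p.
  by case: p => x t /cyl [/= Ox]; rewrite in_itv/= => /andP[t_gt0 _]; exact: umin.
move=> /(_ min'); rewrite derive1_test sube_ge0// ?orbT//.
rewrite (@Lambda1_testE _ s hs N _ x0 q (- c)
  (A * expR (- l * t0) + (B * expR (- m * t0) + gam * t0)) M d)//.
exact: inf_witness.
Unshelve. all: by end_near. Qed.

(** The elliptic viscosity inequalities tested with paraboloids only: the part that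
the comparison uses, and one that constants and gaussians satisfy by a direct
computation. *)
Definition quad_super h (f : 'rV[R]_N -> R) := forall q p c, Omega q -> 0 < c ->
  (forall y, Omega y -> h q + c * sqdist q p <= h y + c * sqdist y p) ->
  super_at s h q (- f q) c.

Definition quad_sub h (f : 'rV[R]_N -> R) := forall p q c, Omega p -> 0 < c ->
  (forall x, Omega x -> h x - c * sqdist x q <= h p - c * sqdist p q) ->
  sub_at s h p (- f p) c.

Lemma smooth_quad (c : R) q : smooth (fun x : 'rV[R]_N => c * sqdist x q).
Proof. by move=> k; apply: CkM; [exact: Ck_cst|exact: smooth_sqdist]. Qed.

Lemma elliptic_quad_sub g h f (M : R) : continuous h -> bounded_by M h ->
  elliptic_subsolution s Omega f g h -> quad_sub h f.
Proof.
move=> ch bh [_ _ _ sub] p q c Op c0 hmax; rewrite /sub_at; near=> d => theta th.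
have d0 : 0 < d by near: d; exact: nbhs_right_gt.
have dO : eball p d `<=` Omega by near: d; exact: eball_sub.
have := sub _ p d (smooth_quad c q) d0 Op dO (fun x xd => hmax x (dO _ xd)).
rewrite (@Lambda1_testE _ s hs N _ p q c 0 M d)//; last by move=> y; rewrite addr0.
rewrite leeNl -EFinN => /le_trans/(_ (ereal_inf_lbound (imageP _ th))).
by rewrite lee_fin.
Unshelve. all: by end_near. Qed.

Lemma elliptic_quad_super g h f (M : R) : continuous h -> bounded_by M h ->
  elliptic_supersolution s Omega f g h -> quad_super h f.
Proof.
move=> ch bh [_ _ _ sup] q p c Oq c0 hmin; rewrite /super_at; near=> d => e e0.
have d0 : 0 < d by near: d; exact: nbhs_right_gt.
have dO : eball q d `<=` Omega by near: d; exact: eball_sub.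
have min' x : eball q d x -> h q - - c * sqdist q p <= h x - - c * sqdist x p.
  by move=> /dO /hmin; rewrite !mulNr !opprK.
have := sup _ q d (smooth_quad (- c) p) d0 Oq dO min'.
rewrite (@Lambda1_testE _ s hs N _ q p (- c) 0 M d)//; last by move=> y; rewrite addr0.
rewrite leeNr -EFinN; exact: inf_witness.
Unshelve. all: by end_near. Qed.

Lemma semicontinuous_continuous (f : 'rV[R]_N -> R) : upper_semicontinuous f ->
  lower_semicontinuous (fun x => (f x)%:E) -> continuous f.
Proof.
move=> us ls x; apply/(@cvgrPdist_lt _ _ _ (nbhs x)) => e e0.
have [|A nA hA] := us x (- f x - e).
  by rewrite lte_fin ltrBlDr ltrDl.
have [|B nB hB] := ls x (f x - e).
  by rewrite lte_fin ltrBlDr ltrDl.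
apply: filterS (filterI nA nB) => y [/hA + /hB]; rewrite !lte_fin => h1 h2.
by rewrite ltr_norml; apply/andP; split; lra.
Qed.

End Evolution.

(** * Comparison of the evolution with separated functions *)
(** Below, [h] is an elliptic super- or subsolution with right hand side [l h], so
that [W exp(- l t) h] solves the evolution inequality in the domain.  The barrier
[C exp(- m t)] acts only in the domain: the exterior inequalities are required
without it. *)
Section Comparison.
Context {R : realType} (s : R) (hs : 1 / 2 < s < 1) {N : nat}.
Context (Omega : set 'rV[R]_N) (oOmega : open Omega) (rho0 D : R).
Context (Orho : forall x, Omega x -> `|x| <= rho0) (D0 : 0 < D)
  (exitD : forall p theta tau, Omega p -> esphere theta -> D <= `|tau| ->
     ~ Omega (p + tau *: theta)).
Context (g u0 : 'rV[R]_N -> R) (u : 'rV[R]_N * R -> R).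
Context (su : evolution_solution s Omega g u0 u).
Context (h : 'rV[R]_N -> R) (Mh l W C m : R) (ch : continuous h) (bh : bounded_by Mh h)
  (l0 : 0 <= l) (W0 : 0 < W) (C0 : 0 <= C) (mD : m <= shellmass s D).

Let sep (p : 'rV[R]_N * R) : R := W * expR (- l * `|p.2|) * h p.1.

Lemma continuous_sep : continuous sep.
Proof.
move=> p; apply: (@continuousM _ _ (fun p : 'rV[R]_N * R => W * expR (- l * `|p.2|)) (fun p => h p.1)).
  apply: cvgMl_tmp.
  apply: (@continuous_comp _ _ _ (fun p : 'rV[R]_N * R => - l * `|p.2|) expR); last exact: continuous_expR.
  by apply: cvgMl_tmp; apply: cvg_norm; exact: cvg_snd.
by apply: (@continuous_comp _ _ _ fst h); [exact: cvg_fst|exact: ch].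
Qed.

Lemma bounded_sep p : `|sep p| <= W * Mh.
Proof.
have w0 : 0 <= W * expR (- l * `|p.2|) by rewrite mulr_ge0 ?ltW ?expR_gt0.
rewrite normrM (ger0_norm w0); apply: ler_pM => //.
rewrite -[leRHS]mulr1 ler_wpM2l ?(ltW W0)// -expR0 ler_expR mulNr oppr_le0.
by rewrite mulr_ge0.
Qed.

Let sepE x (t : R) : 0 <= t -> sep (x, t) = W * expR (- l * t) * h x.
Proof. by move=> t0; rewrite /sep /= ger0_norm. Qed.

Theorem evolution_le_separated :
  quad_super s Omega h (fun x => l * h x) ->
  (forall x t, ~ Omega x -> 0 <= t -> g x <= W * expR (- l * t) * h x) ->
  (forall x, Omega x -> u0 x <= W * h x + C) ->
  forall x t, 0 <= t -> u (x, t) <= W * expR (- l * t) * h x + C * expR (- m * t).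
Proof.
move=> hh out init x t t0.
have [cu [M bu] ug ui] := evolution_solution_data su.
pose M' := Num.max M (W * Mh).
have := @doubling_comparison R s hs N Omega rho0 D Orho D0 exitD (even_ext u) sep M' C m cu
  continuous_sep _ _ C0 mD _ _ _ x t t0.
rewrite sepE// even_extE//; apply.
- by move=> p; rewrite (le_trans (bu p))// le_max lexx.
- by move=> p; rewrite (le_trans (bounded_sep p))// le_max lexx orbT.
- by move=> y r nO r0; rewrite sepE// even_extE// ug// out.
- by move=> y Oy; rewrite sepE// even_extE// mulr0 expR0 mulr1 ui// init.
move=> c gam p q r c0 gam0 Op Oq r0 dmax.
pose w := W * expR (- l * r).
have w0 : 0 < w by rewrite mulr_gt0 ?expR_gt0.
(* The time derivative of the test function for [u], and the right hand side of
   the equation of [h] at [q]; the terms in [l] cancel in the difference. *)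
exists (- l * (W * h q * expR (- l * r)) + (- m * (C * expR (- m * r)) + gam)), (w * (- (l * h q))).
split.
- rewrite even_ext_slice ?ltW//.
  apply: (evolution_sub_at hs oOmega su Op r0 (q := q)) => y r' Oy r'0.
  have := dmax y q r' Oy Oq r'0.
  rewrite /doubled !(sepE _ (ltW r0)) !(sepE _ (ltW r'0))
    !(even_extE _ _ (ltW r0)) !(even_extE _ _ (ltW r'0)) /test_fun /=.
  by lra.
- rewrite (_ : (fun y => sep (y, r)) = (fun y => w * h y)); last first.
    by apply/funext => y; rewrite sepE ?ltW.
  have -> : c = w * (c / w) by rewrite mulrCA mulfV ?mulr1// gt_eqF.
  apply: (super_at_scale hs ch bh w0).
  apply: (hh q p (c / w)) => //; first exact: divr_gt0.
  move=> y Oy; have := dmax p y r Op Oy r0.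
  rewrite /doubled !(sepE _ (ltW r0)) -/w (sqdistC p y) (sqdistC p q) => H.
  have E (X : R) : w * (c / w * X) = c * X by field; rewrite gt_eqF.
  rewrite -(ler_pM2l w0) !mulrDr !E.
  by move: H; lra.
- by rewrite /w; lra.
Qed.

Theorem separated_le_evolution :
  quad_sub s Omega h (fun x => l * h x) ->
  (forall x t, ~ Omega x -> 0 <= t -> W * expR (- l * t) * h x <= g x) ->
  (forall x, Omega x -> W * h x <= u0 x + C) ->
  forall x t, 0 <= t -> W * expR (- l * t) * h x <= u (x, t) + C * expR (- m * t).
Proof.
move=> hh out init x t t0.
have [cu [M bu] ug ui] := evolution_solution_data su.
pose M' := Num.max M (W * Mh).
have := @doubling_comparison R s hs N Omega rho0 D Orho D0 exitD sep (even_ext u) M' C m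
  continuous_sep cu _ _ C0 mD _ _ _ x t t0.
rewrite sepE// even_extE//; apply.
- by move=> p; rewrite (le_trans (bounded_sep p))// le_max lexx orbT.
- by move=> p; rewrite (le_trans (bu p))// le_max lexx.
- by move=> y r nO r0; rewrite sepE// even_extE// ug// out.
- by move=> y Oy; rewrite sepE// even_extE// mulr0 expR0 mulr1 ui// init.
move=> c gam p q r c0 gam0 Op Oq r0 dmax.
pose w := W * expR (- l * r).
have w0 : 0 < w by rewrite mulr_gt0 ?expR_gt0.
(* As before with the roles exchanged: here [u] is touched from below. *)
exists (w * (- (l * h p))), (- l * (W * h p * expR (- l * r)) + (- m * (- C * expR (- m * r)) + - gam)).
split.
- rewrite (_ : (fun y => sep (y, r)) = (fun y => w * h y)); last first.
    by apply/funext => y; rewrite sepE ?ltW.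
  have -> : c = w * (c / w) by rewrite mulrCA mulfV ?mulr1// gt_eqF.
  apply: (sub_at_scale hs ch bh (ltW w0)).
  apply: (hh p q (c / w)) => //; first exact: divr_gt0.
  move=> y Oy; have := dmax y q r Oy Oq r0.
  rewrite /doubled !(sepE _ (ltW r0)) -/w => H.
  have E (X : R) : w * (c / w * X) = c * X by field; rewrite gt_eqF.
  rewrite -(ler_pM2l w0) !mulrBr !E.
  by move: H; lra.
- rewrite even_ext_slice ?ltW//.
  apply: (evolution_super_at hs oOmega su Oq r0 (q := p)) => y r' Oy r'0.
  have := dmax p y r' Op Oy r'0.
  rewrite /doubled !(sepE _ (ltW r0)) !(sepE _ (ltW r'0))
    !(even_extE _ _ (ltW r0)) !(even_extE _ _ (ltW r'0)) /test_fun /=.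
  rewrite (sqdistC p y) (sqdistC p q).
  by lra.
- by rewrite /w; lra.
Qed.

End Comparison.

(** * Constants and gaussians *)
Section Directions.
Context {R : realType} {N : nat}.
Implicit Types (x y v : 'rV[R]_N).

Lemma dotC x y : dot x y = dot y x.
Proof. by apply: eq_bigr => i _; rewrite mulrC. Qed.

Lemma dotDl x y v : dot (x + y) v = dot x v + dot y v.
Proof. by rewrite /dot -big_split; apply: eq_bigr => i _; rewrite !mxE mulrDl. Qed.

Lemma dotZl a x y : dot (a *: x) y = a * dot x y.
Proof. by rewrite /dot mulr_sumr; apply: eq_bigr => i _; rewrite !mxE mulrA. Qed.

Lemma dot_delta i x : dot (delta_mx 0 i) x = x 0 i.
Proof.
rewrite /dot (bigD1 i)//= mxE !eqxx mul1r big1 ?addr0// => j ji.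
by rewrite mxE (negbTE ji) andbF mul0r.
Qed.

Lemma esphere_normalize v : dot v v != 0 -> esphere ((enorm v)^-1 *: v).
Proof.
move=> v0; have n0 : 0 < enorm v by rewrite sqrtr_gt0 lt_neqAle eq_sym v0 dot_ge0.
rewrite /esphere /= {1}/enorm dotZl dotC dotZl mulrA -expr2.
rewrite -[X in _ * X](sqr_sqrtr (dot_ge0 v)) -/(enorm v) -exprMn mulVf ?gt_eqF//.
by rewrite expr1n sqrtr1.
Qed.

Lemma esphere_nonempty : (0 < N)%N -> exists v : 'rV[R]_N, esphere v.
Proof.
move=> N0; pose i := Ordinal N0; exists (delta_mx 0 i).
by rewrite /esphere /= /enorm dot_delta mxE !eqxx sqrtr1.
Qed.

Lemma esphere_orthogonal x : (1 < N)%N -> exists2 v : 'rV[R]_N, esphere v & dot v x = 0.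
Proof.
move=> N1; pose i := Ordinal (ltnW N1); pose j := Ordinal N1.
have ij : i != j by [].
pose v : 'rV[R]_N := x 0 j *: delta_mx 0 i + (- x 0 i) *: delta_mx 0 j.
have vx : dot v x = 0 by rewrite dotDl !dotZl !dot_delta; ring.
have [v0|v0] := eqVneq (dot v v) 0; last first.
  by exists ((enorm v)^-1 *: v); [exact: esphere_normalize|rewrite dotZl vx mulr0].
exists (delta_mx 0 i).
  by rewrite /esphere /= /enorm dot_delta mxE !eqxx sqrtr1.
rewrite dot_delta; apply/eqP; rewrite -sqrf_eq0 eq_le sqr_ge0 andbT -v0.
have := sqr_coord_le_dot v j.
by rewrite !mxE !eqxx (eq_sym j) (negbTE ij) mulr0 add0r mulr1 sqrrN.
Qed.

Lemma dot_line x v (tau : R) : esphere v -> dot v x = 0 ->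
  dot (x + tau *: v) (x + tau *: v) = dot x x + tau ^+ 2.
Proof.
move=> v1 vx; rewrite dotDl dotZl !(dotC _ (_ + _)) !dotDl !dotZl (dotC x v) vx.
by rewrite (esphere_dot v1); ring.
Qed.

End Directions.

Section Profiles.
Context {R : realType} (s : R) (hs : 1 / 2 < s < 1) {N : nat}.
Context (Omega : set 'rV[R]_N).

Lemma nearmass_ge0 (d : R) : 0 <= nearmass s d.
Proof. by rewrite /nearmass divr_ge0 ?powR_ge0//; case/andP: hs; lra. Qed.

Lemma cst_quad_super (k : R) : (0 < N)%N ->
  quad_super s Omega (fun=> k) (fun=> 0 * k).
Proof.
move=> N0 q p c _ c0 _; rewrite /super_at; near=> d => e e0.
have [v v1] := @esphere_nonempty R N N0.
exists v => //; rewrite far_cst addr0 mul0r oppr0 add0r mulNr.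
by apply: (le_trans _ (ltW e0)); rewrite oppr_le0 mulr_ge0 ?nearmass_ge0// ltW.
Unshelve. all: by end_near. Qed.

Lemma cst_quad_sub (k : R) : quad_sub s Omega (fun=> k) (fun=> 0 * k).
Proof.
move=> p q c _ c0 _; rewrite /sub_at; near=> d => v v1.
by rewrite far_cst addr0 mul0r oppr0 mulr_ge0 ?nearmass_ge0// ltW.
Unshelve. all: by end_near. Qed.

Definition gaussian (a : R) (x : 'rV[R]_N) : R := expR (- a * dot x x).

(** The part [1 <= tau <= 2] of the integral of [(1 - exp(- tau^2)) |tau|^(- 1 - 2 s)],
estimated from below. *)
Definition gaussian_rate : R := (1 - expR (- 1)) * 2 `^ (- (1 + 2 * s)).

Lemma gaussian_rate_gt0 : 0 < gaussian_rate.
Proof. by rewrite mulr_gt0 ?powR_gt0// subr_gt0 expR_lt1; lra. Qed.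

Lemma continuous_gaussian a : continuous (gaussian a).
Proof.
apply: (@Ck_exp _ _ 0); apply: CkM; first exact: Ck_cst.
have := @smooth_sqdist R N 0 0; rewrite /sqdist.
by under eq_fun do rewrite subr0.
Qed.

Lemma bounded_gaussian a : 0 <= a -> bounded_by 1 (gaussian a).
Proof.
move=> a0 x; rewrite ger0_norm ?expR_ge0// -expR0 ler_expR mulNr oppr_le0.
by rewrite mulr_ge0// dot_ge0.
Qed.

(** Scaling of the kernel: the shell is the one on which [a tau^2] starts at [1]. *)
Lemma shellmass_powR (a : R) : 0 < a ->
  shellmass s (a `^ (- 2^-1)) = a `^ s * 2 `^ (- (1 + 2 * s)).
Proof.
move=> a0; have D0 : 0 < a `^ (- 2^-1) by exact: powR_gt0.
rewrite /shellmass kernE ?mulr_gt0// powRM ?ltW// mulrCA mulrC; congr (_ * _).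
rewrite -[X in X * _]powRr1 ?ltW// -powRD; last by rewrite (gt_eqF D0) implybT.
by rewrite -powRrM; congr (_ `^ _); field.
Qed.

(** Along a direction orthogonal to [q] the gaussian is maximal at [q] and, on the
shell, smaller at least by the factor [exp(- 1)].  One such direction bounds the infimum. *)
Lemma gaussian_quad_super (a : R) : (1 < N)%N -> 0 < a ->
  quad_super s Omega (gaussian a) (fun x => (a `^ s * gaussian_rate) * gaussian a x).
Proof.
move=> N1 a0 q p c _ c0 _; rewrite /super_at.
(* So that [a D^2 = 1]. *)
pose D := a `^ (- 2^-1).
have D0 : 0 < D by exact: powR_gt0.
near=> d => e e0.
have d0 : 0 < d by near: d; exact: nbhs_right_gt.
have dD : d < D by near: d; exact: nbhs_right_lt.
have [v v1 vq] := esphere_orthogonal q N1.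
exists v => //.
have [L dL tailL] := tailmass_small hs (4 * 1) d e0.
have hq0 : 0 < gaussian a q by exact: expR_gt0.
have lineE tau : gaussian a (q + tau *: v) = gaussian a q * expR (- (a * tau ^+ 2)).
  by rewrite /gaussian dot_line// -expRD; congr expR; ring.
have e1 : 0 <= 1 - expR (- 1) :> R by rewrite subr_ge0 ltW// expR_lt1; lra.
have := @far_gap R s hs N (gaussian a) (fun=> 0) q q v ((1 - expR (-1)) * gaussian a q) d D L 1
  (@continuous_gaussian a) _ (bounded_gaussian (ltW a0)) _ d0 dD dL _ _ _.
rewrite far_cst shellmass_powR// => H.
have {H} : far s d (gaussian a) q v - 0 <=
   - ((1 - expR (-1)) * gaussian a q) * (a `^ s * 2 `^ (- (1 + 2 * s))) + 4 * 1 * tailmass s L.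
  apply: H.
  - exact: cst_continuous.
  - by move=> x; rewrite normr0.
  - by rewrite mulr_ge0// ltW.
  - move=> tau _; rewrite !subr0 lineE ger_pMr// -expR0 ler_expR oppr_le0.
    by rewrite mulr_ge0 ?sqr_ge0// ltW.
  move=> tau; rewrite /shell/= in_itv/= => /andP[Dt _].
  rewrite !subr0 lineE mulrBl mul1r opprB addrC subrK mulrC ler_wpM2r ?(ltW hq0)//.
  rewrite ler_expR lerN2.
  apply: (@le_trans _ _ (a * D ^+ 2)).
    rewrite -powR_mulrn ?(ltW D0)// /D -powRrM (_ : - 2^-1 * 2%:R = - 1); last by field.
    by rewrite powR_inv1 ?(ltW a0)// mulfV ?gt_eqF.
  by rewrite ler_wpM2l ?(ltW a0)// lerXn2r ?nnegrE ?(ltW D0)// (le_trans (ltW D0)).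
have : 0 <= c * nearmass s d by rewrite mulr_ge0 ?nearmass_ge0// ltW.
by move: tailL; rewrite /gaussian_rate mulNr subr0; lra.
Unshelve. all: by end_near. Qed.

End Profiles.

(** * Decay estimates *)
Section Decay.
Context {R : realType} (s : R) (hs : 1 / 2 < s < 1).

Lemma le_of_exp_decay (a b K m : R) : 0 <= K -> 0 < m ->
  (forall t, 0 <= t -> a <= b + K * expR (- m * t)) -> a <= b.
Proof.
move=> K0 m0 H; apply/ler_addgt0Pr => e e0.
(* At this time [exp(m t) >= 1 + m t = 1 + K / e]. *)
have t0 : 0 <= K / e / m by rewrite !divr_ge0// ltW.
apply: (le_trans (H _ t0)); rewrite lerD2l.
rewrite mulNr mulrCA mulfV ?gt_eqF// mulr1 expRN.
rewrite ler_pdivrMr ?expR_gt0//.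
apply: (@le_trans _ _ (e * (1 + K / e))); last by rewrite ler_wpM2l ?(ltW e0)// expR_ge1Dx.
by rewrite mulrDr mulr1 mulrCA mulfV ?gt_eqF// mulr1 lerDr ltW.
Qed.

Lemma initial_bounded (N : nat) (Omega : set 'rV[R]_N) g u0 u :
  admissible_data s Omega g u0 -> evolution_solution s Omega g u0 u ->
  exists2 B : R, 0 <= B & forall x, `|u0 x| <= B.
Proof.
move=> [_ _ _ bg ug] su; have [_ [M bu] _ ui] := evolution_solution_data su.
have [Mg hg] := bounded_on_bound bg.
exists (Num.max 0 (Num.max M Mg)); first by rewrite le_max lexx.
move=> x; have [Ox|nOx] := pselect (Omega x).
  rewrite -ui// -(even_extE _ _ (lexx 0)).
  by rewrite !le_max bu orbT.
by rewrite ug// !le_max hg// !orbT.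
Qed.

Section Domain.
Context {N : nat} (Omega : set 'rV[R]_N) (rho0 D : R) (N1 : (1 < N)%N)
  (oOmega : open Omega) (Orho : forall x, Omega x -> `|x| <= rho0) (D0 : 0 < D)
  (exitD : forall p theta tau, Omega p -> esphere theta -> D <= `|tau| ->
     ~ Omega (p + tau *: theta)).
Context (g u0 : 'rV[R]_N -> R) (u : 'rV[R]_N * R -> R)
  (ad : admissible_data s Omega g u0) (su : evolution_solution s Omega g u0 u).

Let m := shellmass s D.

Lemma shellmass_gt0 : 0 < shellmass s D.
Proof. by rewrite mulr_gt0// invr_gt0 powR_gt0// normr_gt0 gt_eqF// mulr_gt0. Qed.

(** Constants solve both inequalities, with [l = 0] and no barrier. *)
Lemma evolution_bounded (B : R) : 0 <= B -> (forall x, `|u0 x| <= B) ->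
  forall x t, 0 <= t -> `|u (x, t)| <= B.
Proof.
move=> B0 hB x t t0; have [_ _ _ _ ug] := ad.
have E r : 1 * expR (- 0 * r) = 1 :> R by rewrite oppr0 mul0r expR0 mulr1.
rewrite ler_norml; apply/andP; split.
  have := @separated_le_evolution R s hs N Omega oOmega rho0 D Orho D0 exitD g u0 u su
    (fun=> - B) B 0 1 0 m (@cst_continuous _ _ _) _ (lexx 0) ltr01 (lexx 0) (lexx _)
    (@cst_quad_sub _ _ hs _ _ _) _ _ x t t0.
  rewrite E mul1r mul0r addr0 => H; apply: H.
  - by move=> y; rewrite normrN ger0_norm.
  - move=> y r nO _; rewrite E mul1r -ug//.
    by have := hB y; rewrite ler_norml => /andP[].
  - by move=> y _; rewrite ?mul1r ?addr0; have := hB y; rewrite ler_norml => /andP[].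
have := @evolution_le_separated R s hs N Omega oOmega rho0 D Orho D0 exitD g u0 u su
    (fun=> B) B 0 1 0 m (@cst_continuous _ _ _) _ (lexx 0) ltr01 (lexx 0) (lexx _)
    (@cst_quad_super R s hs N Omega B (ltnW N1)) _ _ x t t0.
rewrite E mul1r mul0r addr0 => H; apply: H.
- by move=> y; rewrite ger0_norm.
- move=> y r nO _; rewrite E mul1r -ug//.
  by have := hB y; rewrite ler_norml => /andP[].
- by move=> y _; rewrite ?mul1r ?addr0; have := hB y; rewrite ler_norml => /andP[].
Qed.

Lemma elliptic_solution_data f h : elliptic_solution s Omega f g h ->
  [/\ continuous h, exists2 M : R, 0 <= M & bounded_by M h &
      forall x, ~ Omega x -> h x = g x].
Proof.
move=> [[bh us lg _] [_ ls gl _]]; split.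
- exact: semicontinuous_continuous.
- have [M hM] := bounded_on_bound bh; exists (Num.max 0 M); first by rewrite le_max lexx.
  by move=> x; rewrite le_max hM// orbT.
- by move=> x nO; apply/eqP; rewrite eq_le lg// gl.
Qed.

(** Comparison with [z] itself, [l = 0], and with the barrier. *)
Lemma evolution_near_elliptic z (C : R) : elliptic_solution s Omega (fun=> 0) g z ->
  0 <= C -> (forall x, Omega x -> `|u0 x - z x| <= C) ->
  forall x t, 0 <= t -> `|u (x, t) - z x| <= C * expR (- m * t).
Proof.
move=> sz C0 hC x t t0.
have [cz [M M0 bz] zg] := elliptic_solution_data sz.
have f0 : (fun=> 0 : R) = (fun x => 0 * z x) by apply/funext => y; rewrite mul0r.
have [sub sup] := sz.
have qsub := elliptic_quad_sub hs oOmega cz bz sub.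
have qsup := elliptic_quad_super hs oOmega cz bz sup.
rewrite f0 in qsub qsup.
have E r : 1 * expR (- 0 * r) = 1 :> R by rewrite oppr0 mul0r expR0 mulr1.
rewrite ler_norml; apply/andP; split.
  have := @separated_le_evolution R s hs N Omega oOmega rho0 D Orho D0 exitD g u0 u su
    z M 0 1 C m cz bz (lexx 0) ltr01 C0 (lexx _) qsub _ _ x t t0.
  rewrite E mul1r => H; rewrite lerBrDr addrC lerBlDr; apply: H.
  - by move=> y r nO _; rewrite E mul1r zg.
  - by move=> y /hC; rewrite mul1r ler_norml => /andP[]; lra.
have := @evolution_le_separated R s hs N Omega oOmega rho0 D Orho D0 exitD g u0 u su
    z M 0 1 C m cz bz (lexx 0) ltr01 C0 (lexx _) qsup _ _ x t t0.
rewrite E mul1r => H; rewrite lerBlDr addrC; apply: H.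
- by move=> y r nO _; rewrite E mul1r zg.
- by move=> y /hC; rewrite mul1r ler_norml => /andP[]; lra.
Qed.

(** Maximum principle for the elliptic problem, obtained from the evolution: [u] stays
in [[- B, B]] and converges to [z]. *)
Lemma elliptic_bounded z (B : R) : elliptic_solution s Omega (fun=> 0) g z ->
  0 <= B -> (forall x, `|u0 x| <= B) -> forall x, `|z x| <= B.
Proof.
move=> sz B0 hB x.
have [cz [M M0 bz] zg] := elliptic_solution_data sz.
have BM : 0 <= B + M by rewrite addr_ge0.
have hC y : Omega y -> `|u0 y - z y| <= B + M.
  by move=> _; rewrite (le_trans (ler_normB _ _))// lerD.
have near_z := evolution_near_elliptic sz BM hC.
have ub t := evolution_bounded B0 hB x (t := t).
rewrite ler_norml; apply/andP; split.
  apply: (@le_of_exp_decay _ _ (B + M) m BM shellmass_gt0) => t t0.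
  have := near_z x t t0; have := ub t t0.
  by rewrite !ler_norml => /andP[? ?] /andP[? ?]; lra.
apply: (@le_of_exp_decay _ _ (B + M) m BM shellmass_gt0) => t t0.
have := near_z x t t0; have := ub t t0.
by rewrite !ler_norml => /andP[? ?] /andP[? ?]; lra.
Qed.

(** [W] makes [W * gaussian a] at least [B + 1] on the domain, where
[|x|^2 <= N rho0^2]. *)
Lemma gaussian_decay (a : R) : (forall x, ~ Omega x -> g x = 0) -> 0 < a ->
  exists K : R, forall x t, 0 <= t ->
    u (x, t) <= K * expR (- (a `^ s * gaussian_rate s * t)).
Proof.
move=> g0 a0; have [B B0 hB] := initial_bounded ad su.
pose W := (B + 1) * expR (a * (N%:R * rho0 ^+ 2)).
have W0 : 0 < W by rewrite mulr_gt0 ?expR_gt0//; lra.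
have l0 : 0 <= a `^ s * gaussian_rate s.
  by rewrite mulr_ge0 ?powR_ge0// ltW// gaussian_rate_gt0.
exists W => x t t0.
have := @evolution_le_separated R s hs N Omega oOmega rho0 D Orho D0 exitD g u0 u su
    (gaussian a) 1 _ W 0 m (@continuous_gaussian _ _ a) (bounded_gaussian (ltW a0)) l0 W0
    (lexx 0) (lexx _) (gaussian_quad_super hs N1 a0) _ _ x t t0.
rewrite mul0r addr0 mulNr => H; apply: (le_trans (H _ _)).
- move=> y r nO _; rewrite g0// mulr_ge0 ?expR_ge0//.
  by rewrite mulr_ge0 ?expR_ge0// ltW.
- move=> y Oy; rewrite addr0.
  have : B + 1 <= W * gaussian a y.
    rewrite /W /gaussian -mulrA -expRD -[leLHS]mulr1 ler_wpM2l; try lra.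
    rewrite -[leLHS]expR0 ler_expR mulNr -mulrBr mulr_ge0 ?(ltW a0)// subr_ge0.
    apply: (@le_trans _ _ (\sum_(i < N) rho0 ^+ 2)).
      apply: ler_sum => i _.
      rewrite -expr2 -(real_normK (num_real _)) lerXn2r ?nnegrE//.
        by rewrite (le_trans _ (Orho Oy)).
      by rewrite (le_trans (coord_le_norm _ _))// Orho.
    by rewrite sumr_const card_ord mulr_natl.
  by have := hB y; rewrite ler_norml => /andP[_ ?]; lra.
rewrite -[leRHS]mulr1 ler_wpM2l//; first by rewrite mulr_ge0 ?expR_ge0// ltW.
by have := bounded_gaussian (ltW a0) x; rewrite ger0_norm// expR_ge0.
Qed.

(** Outside the support of the datum [W * phi <= 0 = u0]; on this compact set [phi]
has a negative maximum, and [W] brings it down to [- (B + 1)]. *)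
Lemma eigenfunction_lower_bound (mu1 : R) : (forall x, ~ Omega x -> g x = 0) ->
  compact (closure [set x | u0 x != 0]) -> closure [set x | u0 x != 0] `<=` Omega ->
  first_eigenvalue s Omega mu1 ->
  exists2 C : R, 0 < C & forall x t, 0 <= t -> - (C * expR (- (mu1 * t))) <= u (x, t).
Proof.
move=> g0 cS SO [mu0 [phi [cphi nphi [sub sup]]]].
have [B B0 hB] := initial_bounded ad su.
have [bphi _ phi_out _] := sub.
have [M' hM'] := bounded_on_bound bphi.
pose M := Num.max 0 M'.
have M0 : 0 <= M by rewrite le_max lexx.
have hM : bounded_by M phi by move=> x; rewrite le_max hM'// orbT.
have qsub := elliptic_quad_sub hs oOmega cphi hM sub.
have [W W0 hW] : exists2 W : R, 0 < W & forall x, Omega x -> W * phi x <= u0 x.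
  have [S0|S0] := pselect (closure [set x | u0 x != 0] !=set0); last first.
    exists 1 => // x Ox; rewrite mul1r.
    have [->|u0x] := eqVneq (u0 x) 0; first by rewrite ltW// nphi.
    by case: S0; exists x; exact: subset_closure.
  have [c cS' cmax] := compact_EVT_max S0 cS (continuous_subspaceT cphi).
  have nc : 0 < - phi c by move: cS'; rewrite inE => /SO /nphi; rewrite oppr_gt0.
  exists ((B + 1) / - phi c); first by rewrite divr_gt0//; lra.
  move=> x Ox; have [->|u0x] := eqVneq (u0 x) 0.
    rewrite mulr_ge0_le0//; last by rewrite ltW// nphi.
    by rewrite divr_ge0 ?(ltW nc)//; lra.
  have Sx : x \in closure [set x | u0 x != 0] by rewrite inE; exact: subset_closure.
  have h1 : (B + 1) / - phi c * phi x <= (B + 1) / - phi c * phi c.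
    by rewrite ler_wpM2l ?cmax// divr_ge0 ?(ltW nc)//; lra.
  apply: (le_trans h1); have := hB x; rewrite ler_norml => /andP[hx _].
  have -> : (B + 1) / - phi c * phi c = - (B + 1).
    by field; rewrite -oppr_eq0 gt_eqF.
  by move: hx; lra.
exists (W * (M + 1)); first by rewrite mulr_gt0//; lra.
move=> x t t0.
have := @separated_le_evolution R s hs N Omega oOmega rho0 D Orho D0 exitD g u0 u su
    phi M mu1 W 0 m cphi hM (ltW mu0) W0 (lexx 0) (lexx _) qsub _ _ x t t0.
rewrite mul0r addr0 => H; apply: (le_trans _ (H _ _)).
- rewrite (_ : - (W * _ * _) = W * expR (- mu1 * t) * - (M + 1)); last by rewrite mulNr; ring.
  rewrite ler_wpM2l ?mulr_ge0 ?expR_ge0 ?(ltW W0)//.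
  by have := hM x; rewrite ler_norml => /andP[? _]; lra.
- move=> y r nO _; rewrite g0// mulr_ge0_le0//; last exact: phi_out.
  by rewrite mulr_ge0 ?expR_ge0// ltW.
- by move=> y Oy; rewrite addr0 hW.
Qed.

End Domain.

End Decay.

Theorem theorem1p3 (R : realType) (s : R) (hs : 1 / 2 < s < 1) :
  (forall (N : nat) (Omega : set 'rV[R]_N),
     (2 < N)%N -> strictly_convex_domain Omega ->
     exists mu : R, 0 < mu /\
     forall u0 : 'rV[R]_N -> R,
     exists C : R, 0 < C /\
     forall (g : 'rV[R]_N -> R) (u : 'rV[R]_N * R -> R) (z : 'rV[R]_N -> R),
       admissible_data s Omega g u0 ->
       evolution_solution s Omega g u0 u ->
       elliptic_solution s Omega (fun=> 0) g z ->
       forall t : R, 0 < t ->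
         (sup_norm_on (closure Omega) (fun x => u (x, t) - z x)%R
            <= (C * expR (- (mu * t)))%:E)%E)
  /\
  (exists H : R, 0 < H /\
     forall (N : nat) (Omega : set 'rV[R]_N)
            (g u0 : 'rV[R]_N -> R) (u : 'rV[R]_N * R -> R) (mu1 : R),
       (2 < N)%N -> strictly_convex_domain Omega ->
       admissible_data s Omega g u0 ->
       evolution_solution s Omega g u0 u ->
       (forall x, ~ Omega x -> g x = 0) ->
       compact (closure [set x | u0 x != 0]) ->
       closure [set x | u0 x != 0] `<=` Omega ->
       first_eigenvalue s Omega mu1 ->
       forall mu : R, 0 < mu ->
       exists C K : R, 0 < C /\
         forall (x : 'rV[R]_N) (t : R), closure Omega x -> 0 < t ->
           - (C * expR (- (mu1 * t))) <= u (x, t)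
             <= K * expR (- (mu `^ s * H * t))).
Proof.
split.
  move=> N Omega N2 [[_ oOmega _ bOmega] _].
  have [rho0 Orho] := bounded_on_bound bOmega.
  have [D D0 exitD] := bounded_exit Orho.
  exists (shellmass s D); split; first exact: shellmass_gt0.
  move=> u0; have [[B [B0 hB]]|nB] := pselect (exists B : R, 0 <= B /\ forall x, `|u0 x| <= B);
    last first.
    exists 1; split=> // g u z ad su.
    have [B B0 hB] := initial_bounded ad su.
    by case: nB; exists B.
  exists (2 * B + 1); split; first by lra.
  move=> g u z ad su sz t t0; apply: ge_ereal_sup => _ [x _ <-].
  rewrite lee_fin -mulNr.
  have hz := elliptic_bounded hs (ltnW N2) oOmega Orho D0 exitD ad su sz B0 hB.
  apply: (evolution_near_elliptic hs oOmega Orho D0 exitD su sz); last exact: ltW.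
    by lra.
  move=> y _; rewrite (le_trans (ler_normB _ _))//.
  by have := hB y; have := hz y; lra.
exists (gaussian_rate s); split; first exact: gaussian_rate_gt0.
move=> N Omega g u0 u mu1 N2 [[_ oOmega _ bOmega] _] ad su g0 cS SO eig mu mu0.
have [rho0 Orho] := bounded_on_bound bOmega.
have [D D0 exitD] := bounded_exit Orho.
have [C C0 lower] := eigenfunction_lower_bound hs oOmega Orho D0 exitD ad su g0 cS SO eig.
have [K upper] := gaussian_decay hs (ltnW N2) oOmega Orho D0 exitD ad su g0 mu0.
exists C, K; split=> // x t _ t0.
by apply/andP; split; [apply: lower|apply: upper]; exact: ltW.
Qed.
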